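(* Let $C$ be a $\mathbb{Z}_2$-graded coalgebra over an algebraically closed field $k$. Consider the simple $C$-comodules modulo their grading (i.e. up to isomorphism and reversal of the grading), and fix a family $\hat F$ containing, for each such class, one indecomposable injective cover of a simple comodule of the class, with its grading chosen such that each $I\in\hat F$ appears as a subcomodule of $C$. Let $\hat F_1\subseteq \hat F$ be the subfamily of those $I$ whose socle $\sigma(I)$ is absolutely simple, and let $\hat F_2=\hat F\setminus\hat F_1$. Then, as $C$-comodules, $$C \;\simeq\; \bigoplus_{I \in \hat F_1} \Bigl(\dim(\sigma(I)_0)\, I \;\oplus\; \dim(\sigma(I)_1)\, I'\Bigr)\;\oplus\; \bigoplus_{I \in \hat F_2} \tfrac{1}{2}\dim(\sigma(I))\, I .$$
   Context: Everything is $\mathbb{Z}_2$-graded. A graded coalgebra $C$ over $k$ is a $\mathbb{Z}_2$-graded vector space with a coassociative comultiplication $\Delta:C\to C\otimes C$ and a counit $\varepsilon:C\to k$, both homogeneous of degree zero. A (right) $C$-comodule is a $\mathbb{Z}_2$-graded vector space $V=V_0\oplus V_1$ with a degree-zero coassociative and counital structure map $\beta:V\to V\otimes C$. $C$ is regarded as a comodule over itself via $\Delta$. Homomorphisms of comodules (in particular isomorphisms) are homogeneous of degree zero; subcomodules are graded subcomodules. ''Simple'', ''semisimple'' and ''indecomposable'' are meant in the graded sense. A simple comodule is called absolutely simple if it is also irreducible in the non-graded sense, i.e. it has no proper nonzero subcomodule even when non-graded subspaces are allowed. The socle $\sigma(W)$ of a comodule $W$ is its largest semisimple subcomodule; $\sigma(W)_0$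 and $\sigma(W)_1$ denote its even and odd parts. A comodule is injective if it splits off as a direct summand from every comodule containing it as a subcomodule. An (indecomposable) injective cover of a simple comodule $S$ is an indecomposable injective comodule whose socle is $S$. For a comodule $W$, $W'$ denotes $W$ with its grading reversed. For a nonnegative integer $m$, $m\,I$ denotes the direct sum of $m$ copies of $I$. *)

(* Defs.v *)
(* MathComp, with the classical layer of MathComp-Analysis. *)
From HB Require Import structures.
From mathcomp Require Import all_boot all_algebra.
From mathcomp Require Import sesquilinear generic_quotient.
From mathcomp Require Import boolp classical_sets functions cardinality fsbigop.

Set Implicit Arguments.
Unset Strict Implicit.
Unset Printing Implicit Defensive.

Import GRing.Theory.
Local Open Scope classical_set_scope.
Local Open Scope quotient_scope.
Local Open Scope ring_scope.

Definition is_subspace (k : fieldType) (V : lmodType k) (W : set V) : Prop :=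
  W 0 /\ forall (a : k) u v, W u -> W v -> W (a *: u + v).

Definition span (k : fieldType) (V : lmodType k) (X : set V) : set V :=
  smallest (@is_subspace k V) X.

Section SubspaceTheory.
Variables (k : fieldType) (V : lmodType k).
Implicit Types W X : set V.

Lemma is_subspaceD W u v : is_subspace W -> W u -> W v -> W (u + v).
Proof. by case=> _ Wl Wu Wv; rewrite -[u]scale1r; apply: Wl. Qed.

Lemma is_subspace_sum W (I : Type) (r : seq I) (P : pred I) (F : I -> V) :
  is_subspace W -> (forall i, P i -> W (F i)) -> W (\sum_(i <- r | P i) F i).
Proof.
by move=> sW WF; apply: big_ind => //; [case: sW | move=> *; apply: is_subspaceD].
Qed.

Lemma span_subspace X : is_subspace (span X).
Proof.
split=> [W [[W0 _] _]//|a u v Xu Xv W [sW XW]].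
by apply: sW.2; [apply: Xu | apply: Xv].
Qed.

Lemma sub_span X : X `<=` span X.
Proof. exact: sub_smallest. Qed.

Lemma span_sub X W : is_subspace W -> X `<=` W -> span X `<=` W.
Proof. by move=> sW XW v; apply. Qed.

End SubspaceTheory.

Section Dimension.
Variables (k : fieldType) (V : lmodType k).

Definition has_dim (W : set V) (n : nat) : Prop :=
  exists e : 'I_n -> V, (forall i, W (e i)) /\
    (forall v, W v -> exists! c : 'rV[k]_n, v = \sum_i c 0 i *: e i).

Definition finite_dim (W : set V) : Prop := exists n, has_dim W n.

(* 0 when W is not finite-dimensional *)
Definition vdim (W : set V) : nat := xget 0%N [set n | has_dim W n].

End Dimension.

(* The tensor product over k of two vector spaces of arbitrary dimension:
   a sequence [:: (u1, v1); ...; (un, vn)] stands for the finite sum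
   u1 ⊗ v1 + ... + un ⊗ vn, and two such sums are identified as soon as every
   bilinear map takes the same value on both. The universal property is given
   by tens_lift_linear, tens_liftE and tens_ext. *)
Section Tensor.
Variables (k : fieldType) (U V : lmodType k).

Definition sum_on (W : lmodType k) (b : U -> V -> W) (s : seq (U * V)) : W :=
  \sum_(p <- s) b p.1 p.2.

Definition tens_rel : rel (seq (U * V)) := fun s t =>
  `[< forall (W : lmodType k) (b : U -> V -> W),
        bilinear_for *:%R *:%R b -> sum_on b s = sum_on b t >].

Lemma tens_rel_refl : reflexive tens_rel.
Proof. by move=> s; apply/asboolP. Qed.

Lemma tens_rel_sym : symmetric tens_rel.
Proof.
by move=> s t; apply/idP/idP => /asboolP h; apply/asboolP => W b hb; rewrite h.
Qed.

Lemma tens_rel_trans : transitive tens_rel.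
Proof.
move=> s t r /asboolP h1 /asboolP h2; apply/asboolP => W b hb.
by rewrite h1// h2.
Qed.

Canonical tens_equiv := EquivRel tens_rel tens_rel_refl tens_rel_sym tens_rel_trans.

Definition tens := {eq_quot tens_rel}.
HB.instance Definition _ := Choice.on tens.

Definition tens_of (s : seq (U * V)) : tens := \pi_{eq_quot tens_rel} s.

Definition tpure (u : U) (v : V) : tens := tens_of [:: (u, v)].

Definition tens_lift (W : lmodType k) (b : U -> V -> W) (x : tens) : W :=
  sum_on b (repr x).

Lemma tens_lift_of (W : lmodType k) (b : U -> V -> W) (s : seq (U * V)) :
  bilinear_for *:%R *:%R b -> tens_lift b (tens_of s) = sum_on b s.
Proof.
move=> hb; have /eqmodP/asboolP h : repr (tens_of s) = s %[mod {eq_quot tens_rel}].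
  by rewrite reprK.
exact: h.
Qed.

Lemma tens_lift_inj (x y : tens) :
  (forall (W : lmodType k) (b : U -> V -> W),
     bilinear_for *:%R *:%R b -> tens_lift b x = tens_lift b y) -> x = y.
Proof.
by move=> h; rewrite -[x]reprK -[y]reprK; apply/eqmodP/asboolP; apply: h.
Qed.

Definition tens_add (x y : tens) : tens := tens_of (repr x ++ repr y).
Definition tens_scale (a : k) (x : tens) : tens :=
  tens_of [seq (a *: p.1, p.2) | p <- repr x].

Section Lift.
Variables (W : lmodType k) (b : U -> V -> W).
Hypothesis hb : bilinear_for *:%R *:%R b.

Lemma tens_lift_add x y :
  tens_lift b (tens_add x y) = tens_lift b x + tens_lift b y.
Proof. by rewrite tens_lift_of// /sum_on big_cat. Qed.

Lemma tens_lift_scale a x : tens_lift b (tens_scale a x) = a *: tens_lift b x.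
Proof.
rewrite tens_lift_of// /tens_lift /sum_on big_map scaler_sumr.
by apply: eq_bigr => -[u v] _ /=; apply: (scalable_linear (hb.1 v)).
Qed.

Lemma tens_lift_nil : tens_lift b (tens_of [::]) = 0.
Proof. by rewrite tens_lift_of// /sum_on big_nil. Qed.
End Lift.

Let liftE := (tens_lift_add, tens_lift_scale, tens_lift_nil).

Lemma tens_addA : associative tens_add.
Proof. by move=> x y z; apply: tens_lift_inj => W b hb; rewrite !liftE// addrA. Qed.
Lemma tens_addC : commutative tens_add.
Proof. by move=> x y; apply: tens_lift_inj => W b hb; rewrite !liftE// addrC. Qed.
Lemma tens_add0 : left_id (tens_of [::]) tens_add.
Proof. by move=> x; apply: tens_lift_inj => W b hb; rewrite !liftE// add0r. Qed.
Lemma tens_addN : left_inverse (tens_of [::]) (tens_scale (-1)) tens_add.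
Proof.
by move=> x; apply: tens_lift_inj => W b hb; rewrite !liftE// scaleN1r addNr.
Qed.

HB.instance Definition _ :=
  GRing.isZmodule.Build tens tens_addA tens_addC tens_add0 tens_addN.

Lemma tens_scaleA a b x : tens_scale a (tens_scale b x) = tens_scale (a * b) x.
Proof. by apply: tens_lift_inj => W f hf; rewrite !liftE// scalerA. Qed.
Lemma tens_scale1 : left_id 1 tens_scale.
Proof. by move=> x; apply: tens_lift_inj => W f hf; rewrite !liftE// scale1r. Qed.
Lemma tens_scaleDr : right_distributive tens_scale +%R.
Proof. by move=> a x y; apply: tens_lift_inj => W f hf; rewrite !liftE// scalerDr. Qed.
Lemma tens_scaleDl x : {morph tens_scale^~ x : a b / a + b}.
Proof. by move=> a b; apply: tens_lift_inj => W f hf; rewrite !liftE// scalerDl. Qed.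

HB.instance Definition _ := GRing.Zmodule_isLmodule.Build k tens
  tens_scaleA tens_scale1 tens_scaleDr tens_scaleDl.

Lemma tens_lift_linear (W : lmodType k) (b : U -> V -> W) :
  bilinear_for *:%R *:%R b -> linear (tens_lift b).
Proof. by move=> hb a x y; rewrite [LHS]tens_lift_add// tens_lift_scale. Qed.

Lemma tens_liftE (W : lmodType k) (b : U -> V -> W) u v :
  bilinear_for *:%R *:%R b -> tens_lift b (tpure u v) = b u v.
Proof. by move=> hb; rewrite tens_lift_of// /sum_on big_seq1. Qed.

Lemma tpure_bilinear : bilinear_for *:%R *:%R tpure.
Proof.
split=> [v a u u'|u a v v']; apply: tens_lift_inj => W b hb;
  rewrite tens_lift_linear// !tens_liftE//; [exact: hb.1 | exact: hb.2].
Qed.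

Lemma tens_sum (x : tens) : x = \sum_(p <- repr x) tpure p.1 p.2.
Proof.
apply: tens_lift_inj => W b hb.
pose f : {linear tens -> W} := HB.pack (tens_lift b)
  (GRing.isLinear.Build _ _ _ _ _ (tens_lift_linear hb)).
rewrite -[RHS]/(f _) linear_sum /=.
by apply: eq_bigr => p _; rewrite tens_liftE.
Qed.

Lemma tens_ext (W : lmodType k) (f g : {linear tens -> W}) :
  (forall u v, f (tpure u v) = g (tpure u v)) -> f =1 g.
Proof.
by move=> fg x; rewrite (tens_sum x) !raddf_sum; apply: eq_bigr => p _; apply: fg.
Qed.

End Tensor.

Notation "u ⊗ v" := (tpure u v) (at level 40, left associativity) : ring_scope.

Section TensorMaps.
Variable k : fieldType.

Lemma tpureDl (U V : lmodType k) a (u u' : U) (v : V) :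
  (a *: u + u') ⊗ v = a *: (u ⊗ v) + u' ⊗ v.
Proof. exact: (tpure_bilinear U V).1. Qed.

Lemma tpureDr (U V : lmodType k) a (u : U) (v v' : V) :
  u ⊗ (a *: v + v') = a *: (u ⊗ v) + u ⊗ v'.
Proof. exact: (tpure_bilinear U V).2. Qed.

Section Map.
Variables (U V U' V' : lmodType k) (f : {linear U -> U'}) (g : {linear V -> V'}).

Definition tmap : tens U V -> tens U' V' := tens_lift (fun u v => f u ⊗ g v).

Lemma tmap_bilinear : bilinear_for *:%R *:%R (fun u v => f u ⊗ g v).
Proof. by split=> [v a u u'|u a v v'] /=; rewrite linearP ?tpureDl ?tpureDr. Qed.

HB.instance Definition _ := GRing.isLinear.Build _ _ _ _ tmap
  (tens_lift_linear tmap_bilinear).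

Lemma tmapE u v : tmap (u ⊗ v) = f u ⊗ g v.
Proof. by rewrite [LHS]tens_liftE//; apply: tmap_bilinear. Qed.
End Map.

Section Assoc.
Variables U V W : lmodType k.

Definition tassoc : tens (tens U V) W -> tens U (tens V W) :=
  tens_lift (fun t w => tens_lift (fun u v => u ⊗ (v ⊗ w)) t).

Lemma tassoc_in (w : W) : bilinear_for *:%R *:%R (fun (u : U) (v : V) => u ⊗ (v ⊗ w)).
Proof. by split=> [v a u u'|u a v v'] /=; rewrite ?tpureDl ?tpureDr. Qed.

Lemma tassoc_bilinear : bilinear_for *:%R *:%R
  (fun (t : tens U V) (w : W) => tens_lift (fun u v => u ⊗ (v ⊗ w)) t).
Proof.
split=> [w|t a w w'] /=; first exact: tens_lift_linear (tassoc_in w).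
rewrite /tens_lift /sum_on scaler_sumr -big_split /=.
by apply: eq_bigr => p _; rewrite !tpureDr.
Qed.

HB.instance Definition _ := GRing.isLinear.Build _ _ _ _ tassoc
  (tens_lift_linear tassoc_bilinear).

Lemma tassocE u v w : tassoc (u ⊗ v ⊗ w) = u ⊗ (v ⊗ w).
Proof.
rewrite [LHS]tens_liftE; last exact: tassoc_bilinear.
by rewrite tens_liftE//; apply: tassoc_in.
Qed.
End Assoc.

Section Unit.
Variable V : lmodType k.

Definition tunitl : tens k^o V -> V := tens_lift (fun (a : k^o) (v : V) => a *: v).
Definition tunitr : tens V k^o -> V := tens_lift (fun (v : V) (a : k^o) => a *: v).

Lemma tunitl_bilinear : bilinear_for *:%R *:%R (fun (a : k^o) (v : V) => a *: v).
Proof.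
split=> [v a b c|b a v v'] /=; first by rewrite scalerDl scalerA.
by rewrite scalerDr !scalerA mulrC.
Qed.
Lemma tunitr_bilinear : bilinear_for *:%R *:%R (fun (v : V) (a : k^o) => a *: v).
Proof. by split=> [a|v]; [apply: tunitl_bilinear.2 | apply: tunitl_bilinear.1]. Qed.

HB.instance Definition _ := GRing.isLinear.Build _ _ _ _ tunitl
  (tens_lift_linear tunitl_bilinear).
HB.instance Definition _ := GRing.isLinear.Build _ _ _ _ tunitr
  (tens_lift_linear tunitr_bilinear).

Lemma tunitlE a v : tunitl (a ⊗ v) = a *: v.
Proof. by rewrite [LHS]tens_liftE//; apply: tunitl_bilinear. Qed.
Lemma tunitrE v a : tunitr (v ⊗ a) = a *: v.
Proof. by rewrite [LHS]tens_liftE//; apply: tunitr_bilinear. Qed.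
End Unit.

End TensorMaps.

(* Z_2-graded vector spaces: the group Z_2 is bool with addition (+), so that
   gpart V false is the even part and gpart V true the odd part. *)
Record gspace (k : fieldType) := GSpace {
  gsort :> lmodType k;
  gpart : bool -> set gsort;
  gpart_subspace : forall g, is_subspace (gpart g);
  gpart_sum : forall v, exists v0 v1,
    [/\ gpart false v0, gpart true v1 & v = v0 + v1];
  gpart_direct : forall v, gpart false v -> gpart true v -> v = 0
}.

(* the degree g part of U ⊗ V *)
Definition tens_part (k : fieldType) (U V : gspace k) (g : bool) : set (tens U V) :=
  span [set t | exists a b u v,
    [/\ a (+) b = g, gpart a u, gpart b v & t = u ⊗ v]].

Record gcoalgebra (k : fieldType) := GCoalgebra {
  coalg_space :> gspace k;
  comul : {linear coalg_space -> tens coalg_space coalg_space};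
  counit : {linear coalg_space -> k^o};
  comul_deg0 : forall g c, gpart g c -> tens_part g (comul c);
  counit_deg0 : forall c : coalg_space, gpart true c -> counit c = 0;
  comulA : forall c,
    tassoc (tmap comul idfun (comul c)) = tmap idfun comul (comul c);
  counitl : forall c, tunitl (tmap counit idfun (comul c)) = c;
  counitr : forall c, tunitr (tmap idfun counit (comul c)) = c
}.

Record comodule (k : fieldType) (C : gcoalgebra k) := Comodule {
  comod_space :> gspace k;
  coact : {linear comod_space -> tens comod_space C};
  coact_deg0 : forall g v, gpart g v -> tens_part g (coact v);
  coactA : forall v,
    tassoc (tmap coact idfun (coact v)) = tmap idfun (comul C) (coact v);
  coact_counit : forall v, tunitr (tmap idfun (counit C) (coact v)) = v
}.

Section Comodules.
Variables (k : fieldType) (C : gcoalgebra k).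
Implicit Types S V W I : comodule C.

Definition regular_comodule : comodule C :=
  @Comodule k C C (comul C) (@comul_deg0 _ C) (@comulA _ C) (@counitr _ C).

Definition comod_hom V W (f : {linear V -> W}) : Prop :=
  (forall g v, gpart g v -> gpart g (f v)) /\
  (forall v, coact W (f v) = tmap f idfun (coact V v)).

Definition comod_iso V W : Prop :=
  exists f : {linear V -> W}, comod_hom f /\ bijective f.

(* W is a possibly non-graded subcomodule of V: the structure map sends W into
   the subspace W ⊗ C of V ⊗ C *)
Definition is_ungraded_subcomod V (W : set V) : Prop :=
  is_subspace W /\
  (forall w, W w -> span [set t | exists u c, W u /\ t = u ⊗ c] (coact V w)).

Definition is_graded_set V (W : set V) : Prop :=
  forall w, W w -> exists w0 w1,
    [/\ gpart false w0 /\ W w0, gpart true w1 /\ W w1 & w = w0 + w1].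

Definition is_subcomod V (W : set V) : Prop :=
  is_ungraded_subcomod W /\ is_graded_set W.

(* Subcomodules are handled as subsets of the ambient comodule; those of a
   subcomodule W of V are the subcomodules of V contained in W. *)
Definition simple_subcomod V (W : set V) : Prop :=
  [/\ is_subcomod W, W <> [set 0] &
      forall X : set V, is_subcomod X -> X `<=` W -> X = [set 0] \/ X = W].

Definition absolutely_simple_subcomod V (W : set V) : Prop :=
  simple_subcomod W /\
  (forall X : set V, is_ungraded_subcomod X -> X `<=` W -> X = [set 0] \/ X = W).

(* a sum of simple subcomodules *)
Definition semisimple_subcomod V (W : set V) : Prop :=
  exists2 F : set (set V), F `<=` @simple_subcomod V & W = span (\bigcup_(X in F) X).

Definition simple_comod V : Prop := simple_subcomod [set: V].

(* the largest semisimple subcomodule, see socle_semisimple and sub_socle *)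
Definition socle V : set V := span (\bigcup_(X in @semisimple_subcomod V) X).
Arguments socle : clear implicits.

Lemma span_bigcup_subcomod V (F : set (set V)) :
  F `<=` @is_subcomod V -> is_subcomod (span (\bigcup_(X in F) X)).
Proof.
move=> sF; set Y := span _; have sY : is_subspace Y by apply: span_subspace.
split; first split=> //.
  set Z := span _; pose Q := [set w | Z (coact V w)].
  have sQ : is_subspace Q.
    have sZ : is_subspace Z by apply: span_subspace.
    by split=> [|a u v Qu Qv]; rewrite /Q /= ?linear0 ?linearP; [apply: sZ.1 | apply: sZ.2].
  apply: (span_sub sQ) => w [X FX Xw]; rewrite /Q /=.
  move: (coact V w) ((sF _ FX).1.2 _ Xw); apply: span_sub; first exact: span_subspace.
  by move=> _ [u [c [Xu ->]]]; apply: sub_span; exists u, c; split=> //; apply: sub_span; exists X.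
pose Q := [set w | exists w0 w1 : V,
    [/\ gpart false w0 /\ Y w0, gpart true w1 /\ Y w1 & w = w0 + w1]].
have sQ : is_subspace Q.
  have P0 b := (@gpart_subspace _ V b).1; have P2 b := (@gpart_subspace _ V b).2.
  split=> [|a u v [u0 [u1 [[? ?] [? ?] ->]]] [v0 [v1 [[? ?] [? ?] ->]]]].
    by exists 0, 0; rewrite addr0; split=> //; split=> //; apply: sY.1.
  exists (a *: u0 + v0), (a *: u1 + v1); split; last by rewrite scalerDr addrACA.
    by split; [apply: P2 | apply: sY.2].
  by split; [apply: P2 | apply: sY.2].
apply: (span_sub sQ) => w [X FX Xw].
have [w0 [w1 [[? ?] [? ?] ->]]] := (sF _ FX).2 _ Xw.
by exists w0, w1; split=> //; split=> //; apply: sub_span; exists X.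
Qed.

Lemma socle_semisimple V : semisimple_subcomod (socle V).
Proof.
exists (@simple_subcomod V) => //; apply/seteqP; split.
  apply: span_sub; first exact: span_subspace.
  move=> v [X [F sF ->]]; apply: span_sub; first exact: span_subspace.
  by move=> u [Y FY Yu]; apply: sub_span; exists Y => //; apply: sF.
apply: span_sub; first exact: span_subspace.
move=> v Xv; apply: sub_span.
exists (span (\bigcup_(X in @simple_subcomod V) X)); last exact: sub_span.
by exists (@simple_subcomod V).
Qed.

Lemma socle_subcomod V : is_subcomod (socle V).
Proof.
have [F sF ->] := socle_semisimple V.
by apply: span_bigcup_subcomod => X /sF[].
Qed.

Lemma sub_socle V (W : set V) : semisimple_subcomod W -> W `<=` socle V.
Proof. by move=> sW w Ww; apply: sub_span; exists W. Qed.

(* V is isomorphic to the subcomodule X of W *)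
Definition comod_iso_onto V W (X : set W) : Prop :=
  exists f : {linear V -> W}, [/\ comod_hom f, injective f & range f = X].

Definition embeds V W : Prop :=
  exists f : {linear V -> W}, comod_hom f /\ injective f.

Definition direct_complements V (X Y : set V) : Prop :=
  X `&` Y = [set 0] /\ (forall v, exists x y, [/\ X x, Y y & v = x + y]).

Definition injective_comod I : Prop :=
  forall W (f : {linear I -> W}), comod_hom f -> injective f ->
    exists2 X : set W, is_subcomod X & direct_complements (range f) X.

Definition indecomposable_comod V : Prop :=
  [set: V] <> [set 0] /\
  (forall X Y : set V, is_subcomod X -> is_subcomod Y -> direct_complements X Y ->
     X = [set 0] \/ Y = [set 0]).

Definition injective_cover S I : Prop :=
  [/\ indecomposable_comod I, injective_comod I & comod_iso_onto S (socle I)].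

Definition absolutely_simple_socle V : Prop :=
  absolutely_simple_subcomod (socle V).

End Comodules.
Arguments socle {k C} V.
Arguments regular_comodule {k} C.

Definition socle_part (k : fieldType) (C : gcoalgebra k) (V : comodule C)
    (g : bool) : set V :=
  socle V `&` gpart g.
Arguments socle_part {k C} V g.

Section Shift.
Variables (k : fieldType) (C : gcoalgebra k) (V : comodule C).

Definition shift_gspace (U : gspace k) : gspace k.
Proof.
refine (@GSpace k U (fun g => @gpart k U (~~ g)) _ _ _).
- by move=> g; apply: gpart_subspace.
- by move=> v; have [v0 [v1 [? ? ->]]] := gpart_sum v; exists v1, v0; rewrite addrC.
- by move=> v h1 h0; apply: gpart_direct.
Defined.

Lemma shift_deg0 g (v : shift_gspace V) :
  gpart g v -> @tens_part k (shift_gspace V) C g (coact V v).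
Proof.
move=> gv; have := coact_deg0 gv; move: (coact V _); apply: span_sub.
  exact: span_subspace.
move=> _ [a [b [u [c [abg Vu Cc ->]]]]]; apply: sub_span.
exists (~~ a), b, u, c; split=> //=; last by rewrite negbK.
by rewrite addNb abg negbK.
Qed.

(* V with its grading reversed *)
Definition shift : comodule C :=
  @Comodule k C (shift_gspace V) (coact V) shift_deg0 (@coactA k C V)
    (@coact_counit k C V).

End Shift.

Section DirectSumSpace.
Variables (k : fieldType) (T : choiceType) (M : T -> lmodType k).

(* finitely supported families *)
Record dsum := Dsum {
  dsum_val :> forall t, M t;
  dsum_finite : finite_set [set t | dsum_val t != 0]
}.

HB.instance Definition _ := gen_eqMixin dsum.
HB.instance Definition _ := gen_choiceMixin dsum.

Lemma dsumP (x y : dsum) : (forall t, x t = y t) -> x = y.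
Proof.
case: x y => [f hf] [g hg] /= fg; have {}fg : f = g by apply: functional_extensionality_dep.
by subst g; congr Dsum; apply: Prop_irrelevance.
Qed.

Lemma dsum_lin_finite (a : k) (x y : dsum) :
  finite_set [set t | a *: x t + y t != 0].
Proof.
apply: (@sub_finite_set _ _ ([set t | x t != 0] `|` [set t | y t != 0])).
  move=> t /= h; case: (eqVneq (x t) 0) => [x0|]; last by left.
  by right; move: h; rewrite x0 scaler0 add0r.
by rewrite finite_setU; split; apply: dsum_finite.
Qed.

Lemma dsum_zero_finite : finite_set [set t | (0 : M t) != 0].
Proof. by rewrite (_ : [set _ | _] = set0)//; apply/seteqP; split=> t //=; rewrite eqxx. Qed.

Definition dsum_zero : dsum := Dsum dsum_zero_finite.
Definition dsum_lin (a : k) (x y : dsum) : dsum := Dsum (dsum_lin_finite a x y).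
Definition dsum_add (x y : dsum) : dsum := dsum_lin 1 x y.
Definition dsum_scale (a : k) (x : dsum) : dsum := dsum_lin a x dsum_zero.

Lemma dsum_addA : associative dsum_add.
Proof. by move=> x y z; apply: dsumP => t /=; rewrite !scale1r addrA. Qed.
Lemma dsum_addC : commutative dsum_add.
Proof. by move=> x y; apply: dsumP => t /=; rewrite !scale1r addrC. Qed.
Lemma dsum_add0 : left_id dsum_zero dsum_add.
Proof. by move=> x; apply: dsumP => t /=; rewrite !scale1r add0r. Qed.
Lemma dsum_addN : left_inverse dsum_zero (dsum_scale (-1)) dsum_add.
Proof. by move=> x; apply: dsumP => t /=; rewrite scale1r addr0 scaleN1r addNr. Qed.

HB.instance Definition _ :=
  GRing.isZmodule.Build dsum dsum_addA dsum_addC dsum_add0 dsum_addN.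

Lemma dsum_scaleA a b x : dsum_scale a (dsum_scale b x) = dsum_scale (a * b) x.
Proof. by apply: dsumP => t /=; rewrite !addr0 scalerA. Qed.
Lemma dsum_scale1 : left_id 1 dsum_scale.
Proof. by move=> x; apply: dsumP => t /=; rewrite addr0 scale1r. Qed.
Lemma dsum_scaleDr : right_distributive dsum_scale +%R.
Proof. by move=> a x y; apply: dsumP => t /=; rewrite !addr0 !scale1r scalerDr. Qed.
Lemma dsum_scaleDl x : {morph dsum_scale^~ x : a b / a + b}.
Proof. by move=> a b; apply: dsumP => t /=; rewrite !addr0 scale1r scalerDl. Qed.

HB.instance Definition _ := GRing.Zmodule_isLmodule.Build k dsum
  dsum_scaleA dsum_scale1 dsum_scaleDr dsum_scaleDl.

Lemma dsumDE (x y : dsum) t : (x + y) t = x t + y t.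
Proof. by rewrite /= scale1r. Qed.
Lemma dsumZE a (x : dsum) t : (a *: x) t = a *: x t.
Proof. by rewrite /= addr0. Qed.
Lemma dsum0E t : (0 : dsum) t = 0.
Proof. by []. Qed.

Lemma dsum_in_finite t (m : M t) :
  finite_set [set s | dfwith (fun s => 0 : M s) m s != 0].
Proof.
apply: (@sub_finite_set _ _ [set t]); last exact: finite_set1.
by move=> s /=; case: dfwithP => //= j _; rewrite eqxx.
Qed.

Definition dsum_in t (m : M t) : dsum := Dsum (dsum_in_finite m).

Lemma dsum_in_linear t : linear (@dsum_in t).
Proof.
move=> a x y; apply: dsumP => s; rewrite dsumDE dsumZE /=.
have [<-|ts] := eqVneq t s; first by rewrite !dfwith_in.
by rewrite !dfwith_out// scaler0 addr0.
Qed.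

HB.instance Definition _ t := GRing.isLinear.Build _ _ _ _ (@dsum_in t)
  (@dsum_in_linear t).

Section Lift.
Variables (W : lmodType k) (h : forall t, {linear M t -> W}).

Definition dsum_lift (x : dsum) : W := \sum_(t \in [set: T]) h t (x t).

Lemma dsum_lift_seq (r : seq T) (x : dsum) :
  uniq r -> (forall t, x t != 0 -> t \in r) ->
  dsum_lift x = \sum_(t <- r) h t (x t).
Proof.
move=> ur xr; rewrite /dsum_lift (fsbigE r)//.
  by apply: eq_bigl => t; rewrite in_setT.
by move=> t _ tr; have [->|/xr] := eqVneq (x t) 0; [rewrite linear0 | rewrite (negbTE tr)].
Qed.

Lemma dsum_supp (x : dsum) : exists r : seq T, forall t, x t != 0 -> t \in r.
Proof.
have /finite_seqP[r xr] := dsum_finite x; exists r => t xt.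
by have : [set t | x t != 0] t by []; rewrite xr.
Qed.

Lemma dsum_lift_linear : linear dsum_lift.
Proof.
move=> a x y; have [r1 h1] := dsum_supp x; have [r2 h2] := dsum_supp y.
have ur := undup_uniq (r1 ++ r2).
rewrite !(dsum_lift_seq ur); first 1 last.
- by move=> t /h2; rewrite mem_undup mem_cat => ->; rewrite orbT.
- by move=> t /h1; rewrite mem_undup mem_cat => ->.
- move=> t; rewrite dsumDE dsumZE mem_undup mem_cat; have [x0|/h1->//] := eqVneq (x t) 0.
  by rewrite x0 scaler0 add0r => /h2->; rewrite orbT.
rewrite scaler_sumr -big_split /=; apply: eq_bigr => t _.
by rewrite addr0 scale1r linearP.
Qed.

HB.instance Definition _ := GRing.isLinear.Build _ _ _ _ dsum_lift dsum_lift_linear.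

Lemma dsum_liftE t (m : M t) : dsum_lift (dsum_in m) = h t m.
Proof.
rewrite (@dsum_lift_seq [:: t])//= ?big_seq1 ?dfwith_in// => s.
by rewrite inE; case: dfwithP => [|j]; rewrite ?eqxx.
Qed.
End Lift.

Lemma dsum_sum (x : dsum) : exists r : seq T, x = \sum_(t <- r) dsum_in (x t).
Proof.
have [r xr] := dsum_supp x; exists (undup r).
have {}xr t : x t != 0 -> t \in undup r by rewrite mem_undup; apply: xr.
apply: dsumP => s.
have evE (F : T -> dsum) q : (\sum_(t <- q) F t) s = \sum_(t <- q) F t s.
  by elim: q => [|t q IH]; rewrite ?big_nil// !big_cons dsumDE IH.
rewrite evE; have [sr|/negP sr] := boolP (s \in undup r).
  rewrite (bigD1_seq s)//= ?undup_uniq// dfwith_in big1 ?addr0// => t ts.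
  by rewrite dfwith_out.
rewrite big1_seq => [|t /andP[_ tr]] /=.
  by apply: contrapT => /eqP/xr.
by rewrite dfwith_out//; apply: contra_notN sr => /eqP<-.
Qed.

Lemma dsum_ext (W : lmodType k) (f g : {linear dsum -> W}) :
  (forall t (m : M t), f (dsum_in m) = g (dsum_in m)) -> f =1 g.
Proof.
move=> fg x; have [r ->] := dsum_sum x.
by rewrite !linear_sum; apply: eq_bigr => t _; apply: fg.
Qed.

End DirectSumSpace.

Section DirectSum.
Variables (k : fieldType) (C : gcoalgebra k) (T : choiceType) (M : T -> comodule C).

Let D := dsum (fun t => M t : lmodType k).
Let inj t : {linear M t -> D} := @dsum_in k T (fun t => M t) t.

Lemma dsum_part_sum (x : D) : exists x0 x1 : D,
  [/\ forall t, gpart false (x0 t), forall t, gpart true (x1 t) & x = x0 + x1].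
Proof.
have p t : {v : M t * M t | [/\ gpart false v.1, gpart true v.2 & x t = v.1 + v.2]}.
  by apply: cid; have [v0 [v1 h]] := gpart_sum (x t); exists (v0, v1).
have p0 t : x t = 0 -> (sval (p t)).1 = 0 /\ (sval (p t)).2 = 0.
  case: (p t) => -[v0 v1] /= [h0 h1 ->] /eqP; rewrite addr_eq0 => /eqP v01.
  suff v10 : v1 = 0 by rewrite v01 v10 oppr0.
  apply: gpart_direct => //; rewrite -[v1]opprK -v01 -scaleN1r -[_ *: _]addr0.
  by apply: (gpart_subspace _ _).2 => //; apply: (gpart_subspace _ _).1.
have f0 : finite_set [set t | (sval (p t)).1 != 0].
  apply: sub_finite_set (dsum_finite x) => t /=; apply: contra_neq => /p0[].
  by [].
have f1 : finite_set [set t | (sval (p t)).2 != 0].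
  by apply: sub_finite_set (dsum_finite x) => t /=; apply: contra_neq => /p0[].
exists (Dsum f0), (Dsum f1); split=> [t|t|]; first 1 last.
- by rewrite /=; case: (p t) => v [].
- by apply: dsumP => t; rewrite dsumDE /=; case: (p t) => v [].
- by rewrite /=; case: (p t) => v [].
Qed.

Definition dsum_gspace : gspace k.
Proof.
refine (@GSpace k D (fun g => [set x : D | forall t, gpart g (x t)]) _ _ _).
- move=> g; split=> [t|a x y gx gy t]; first exact: (gpart_subspace _ _).1.
  by rewrite dsumDE dsumZE; apply: (gpart_subspace _ _).2.
- exact: dsum_part_sum.
- by move=> x x0 x1; apply: dsumP => t; apply: gpart_direct; [apply: x0|apply: x1].
Defined.

Definition dsum_coact : D -> tens D C :=
  dsum_lift (fun t => tmap (inj t) idfun \o coact (M t)).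

HB.instance Definition _ := GRing.Linear.on dsum_coact.

Lemma dsum_coactE t (m : M t) :
  dsum_coact (inj t m) = tmap (inj t) idfun (coact (M t) m).
Proof. exact: dsum_liftE. Qed.

Lemma dsum_coact_deg0 g (x : dsum_gspace) :
  gpart g x -> @tens_part k dsum_gspace C g (dsum_coact x).
Proof.
move=> gx; apply: is_subspace_sum => [|t _]; first exact: span_subspace.
move: (coact_deg0 (gx t)); rewrite /=.
pose Q := [set y : tens (M t) C |
  @tens_part k dsum_gspace C g (tmap (inj t) idfun y)].
have sS : is_subspace (@tens_part k dsum_gspace C g) by apply: span_subspace.
have sQ : is_subspace Q.
  by split=> [|a y z]; rewrite /Q /= ?linear0 ?linearP; [apply: sS.1 | apply: sS.2].
apply: (span_sub sQ) => _ [a [b [u [c [abg gu gc ->]]]]].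
rewrite /Q /= tmapE; apply: sub_span; exists a, b, (inj t u), c; split=> //.
move=> s /=; case: dfwithP => // j _; exact: (gpart_subspace _ _).1.
Qed.

Lemma dsum_coactA (x : D) :
  tassoc (tmap dsum_coact idfun (dsum_coact x)) =
  tmap idfun (comul C) (dsum_coact x).
Proof.
pose f : {linear D -> _} := (tassoc (W := C) \o tmap dsum_coact idfun) \o dsum_coact.
pose g : {linear D -> _} := tmap idfun (comul C) \o dsum_coact.
rewrite -[LHS]/(f x) -[RHS]/(g x); apply: dsum_ext => t m {x}.
rewrite /f /g /= dsum_coactE; move: (coactA m) => cA.
have -> (y : tens (M t) C) : tmap idfun (comul C) (tmap (inj t) idfun y) =
    tmap (inj t) idfun (tmap idfun (comul C) y).
  pose f1 : {linear tens (M t) C -> _} := tmap idfun (comul C) \o tmap (inj t) idfun.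
  pose g1 : {linear tens (M t) C -> _} := tmap (inj t) idfun \o tmap idfun (comul C).
  rewrite -[LHS]/(f1 y) -[RHS]/(g1 y); apply: tens_ext => u c.
  by rewrite /f1 /g1 /= !tmapE.
rewrite -cA.
pose f1 : {linear tens (M t) C -> _} :=
  (tassoc (W := C) \o tmap dsum_coact idfun) \o tmap (inj t) idfun.
pose g1 : {linear tens (M t) C -> _} :=
  tmap (inj t) idfun \o (tassoc (W := C) \o tmap (coact (M t)) idfun).
rewrite -[LHS]/(f1 _) -[RHS]/(g1 _); apply: tens_ext => u c {m cA}.
rewrite /f1 /g1 /= !tmapE /= dsum_coactE; move: (coact (M t) u) => z.
have lc (U V W : lmodType k) (w : W) : linear (fun v : tens U V => v ⊗ w).
  by move=> a v v'; rewrite tpureDl.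
pose lw (U V : lmodType k) : {linear tens U V -> tens (tens U V) C} :=
  HB.pack (fun v : tens U V => v ⊗ c) (GRing.isLinear.Build _ _ _ _ _ (lc U V C c)).
pose f2 : {linear tens (M t) C -> _} := (tassoc (W := C) \o lw _ _) \o tmap (inj t) idfun.
pose g2 : {linear tens (M t) C -> _} := tmap (inj t) idfun \o (tassoc (W := C) \o lw _ _).
rewrite -[LHS]/(f2 _) -[RHS]/(g2 _); apply: tens_ext => v d.
by rewrite /f2 /g2 /= !(tmapE, tassocE).
Qed.

Lemma dsum_coact_counit (x : D) : tunitr (tmap idfun (counit C) (dsum_coact x)) = x.
Proof.
pose f : {linear D -> D} := (@tunitr _ _ \o tmap idfun (counit C)) \o dsum_coact.
rewrite -[LHS]/(f x) -[RHS]/(idfun x); apply: dsum_ext => t m {x}.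
rewrite /f /= dsum_coactE -[in RHS](coact_counit m).
pose f1 : {linear tens (M t) C -> D} :=
  (@tunitr _ _ \o tmap idfun (counit C)) \o tmap (inj t) idfun.
pose g1 : {linear tens (M t) C -> D} := inj t \o (@tunitr _ _ \o tmap idfun (counit C)).
rewrite -[LHS]/(f1 _) -[RHS]/(g1 _); apply: tens_ext => u c.
by rewrite /f1 /g1 /= !tmapE !tunitrE /= linearZ.
Qed.

Definition comod_dsum : comodule C :=
  @Comodule k C dsum_gspace dsum_coact dsum_coact_deg0 dsum_coactA dsum_coact_counit.

End DirectSum.

Definition comod_sum2 (k : fieldType) (C : gcoalgebra k) (V W : comodule C) :
  comodule C := comod_dsum (fun b : bool => if b then V else W).

(* m V, the direct sum of m copies of V *)
Definition comod_copies (k : fieldType) (C : gcoalgebra k) (m : nat)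
  (V : comodule C) : comodule C := comod_dsum (fun _ : 'I_m => V).

(* Main.v *)
Require Import Defs.
From HB Require Import structures.
From mathcomp Require Import all_boot all_algebra.
From mathcomp Require Import boolp classical_sets.
From mathcomp Require Import sesquilinear functions cardinality.

(* Composing with the counit identifies the degree b maps from a comodule V to C
   with the functionals on V that vanish off the degree b part. Hence C has the
   extension property of injectives, and so have the I j, which split off from
   it. For a simple S with even endomorphism ring k, the copies of S in the
   socle of C form a space of dimension dim S_0, and those of its shift one of
   dimension dim S_1; S is isomorphic to its shift exactly when S is not
   absolutely simple, and then dim S_0 = dim S_1 is half of dim S. Coordinate
   functionals of the socles of the I j therefore assemble to a map from the
   direct sum to C which is injective on the socle, hence injective, and whose
   range contains the socle of C; comodules being locally finite, the extension
   property of the direct sum makes the map surjective. *)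

Set Implicit Arguments.
Unset Strict Implicit.
Unset Printing Implicit Defensive.

Import GRing.Theory.
Local Open Scope classical_set_scope.
Local Open Scope ring_scope.

(** Injectivity is given only as splitting off from larger comodules, a property that does not
    visibly pass to infinite direct sums. Each [I j] embeds in C and splits off there, so it is a
    retract of C, and retracts inherit the extension property, which is stable under direct sums.
    Algebraic closure enters twice. Schur's lemma needs an eigenvalue. That an absolutely simple
    socle has no odd automorphism u needs a square root c of the scalar by which u^2 acts: the
    eigenspace of u for c is a non-graded subcomodule, and this works in every characteristic. Maps
    of both degrees are treated alike and live on subsets of a comodule, so that simple
    subcomodules, and a comodule and its shift, are compared without changing the ambient
    comodule. *)

Definition linmap (k : fieldType) (U V : lmodType k) (f : U -> V)
  (fl : linear f) : {linear U -> V} :=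
  HB.pack f (GRing.isLinear.Build _ _ _ _ f fl).

(** * Linear algebra in arbitrary dimension *)

Section Subspaces.
Variables (k : fieldType) (V : lmodType k).
Implicit Types W X : set V.

Lemma is_subspaceZ W a v : is_subspace W -> W v -> W (a *: v).
Proof. by case=> W0 Wl Wv; rewrite -[_ *: _]addr0; apply: Wl. Qed.

Lemma is_subspaceB W u v : is_subspace W -> W u -> W v -> W (u - v).
Proof.
by move=> sW Wu Wv; rewrite addrC -scaleN1r; apply: sW.2.
Qed.

Lemma is_subspace0 : is_subspace [set 0 : V].
Proof. by split=> // a u v -> ->; rewrite scaler0 addr0. Qed.

Lemma is_subspaceI W X : is_subspace W -> is_subspace X -> is_subspace (W `&` X).
Proof.
move=> sW sX; split; first by split; [apply: sW.1|apply: sX.1].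
by move=> a u v [? ?] [? ?]; split; [apply: sW.2|apply: sX.2].
Qed.

Lemma subspace_neq0 W : is_subspace W -> W <> [set 0] -> exists2 w, W w & w <> 0.
Proof.
move=> sW W0; apply: contrapT => h; apply: W0; apply/seteqP; split=> [w Ww|_ ->].
  by apply: contrapT => w0; apply: h; exists w.
exact: sW.1.
Qed.

(** Zorn's lemma gives a maximal A meeting W only in 0; a vector outside W + A could still be
    adjoined to A. *)
Lemma subspace_complement W : is_subspace W ->
  exists A, [/\ is_subspace A, forall v, W v -> A v -> v = 0 &
                forall v, exists w a, [/\ W w, A a & v = w + a]].
Proof.
move=> sW.
pose P (A : set V) := A = set0 \/ (is_subspace A /\ forall v, W v -> A v -> v = 0).
have [F FP Ftot|A [PA Amax]] := @Zorn_bigcup V P.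
  have [F0|/existsNP[B /not_implyP[FB B0]]] := EM (forall B, F B -> B = set0).
    by left; apply: bigcup0 => B /F0.
  have BX0 (Z : set V) : F Z -> forall z, Z z ->
      is_subspace Z /\ forall v, W v -> Z v -> v = 0.
    by move=> FZ z Zz; case: (FP _ FZ) => [Z0|//]; move: Zz; rewrite Z0.
  right; split=> [|v Wv [Z FZ Zv]]; last exact: (BX0 _ FZ _ Zv).2.
  split=> [|a u v [X FX Xu] [Y FY Yv]].
    by exists B => //; case: (FP _ FB) => // -[[]].
  have [XY|YX] := Ftot _ _ FX FY.
    by exists Y => //; apply: (BX0 _ FY _ Yv).1.2 => //; apply: XY.
  by exists X => //; apply: (BX0 _ FX _ Xu).1.2 => //; apply: YX.
have {PA} [sA AW] : is_subspace A /\ forall v, W v -> A v -> v = 0.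
  case: PA => // A0; exfalso; apply: (Amax [set 0]).
    by rewrite A0; split=> // /(_ 0 erefl).
  by right; split=> //; apply: is_subspace0.
exists A; split=> // v; apply: contrapT => nv.
pose B : set V := [set a | exists c x, A x /\ a = c *: v + x].
apply: (Amax B).
  split=> [x Ax|/(_ v)]; first by exists 0, x; rewrite scale0r add0r.
  have Bv : B v by exists 1, 0; rewrite scale1r addr0; split=> //; apply: sA.1.
  by move=> /(_ Bv) Av; apply: nv; exists 0, v; rewrite add0r; split=> //; apply: sW.1.
right; split.
  split; first by exists 0, 0; rewrite scale0r addr0; split=> //; apply: sA.1.
  move=> a _ _ [c [x [Ax ->]]] [d [y [Ay ->]]].
  exists (a * c + d), (a *: x + y); split; first exact: sA.2.
  by rewrite scalerDr scalerDl scalerA addrACA.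
move=> w Ww [c [x [Ax wE]]].
have [c0|c0] := eqVneq c 0; first by apply: AW => //; rewrite wE c0 scale0r add0r.
exfalso; apply: nv; exists (c^-1 *: w), (- c^-1 *: x).
split; [exact: is_subspaceZ|exact: is_subspaceZ|].
by rewrite wE scalerDr scalerA mulVf// scale1r scaleNr addrK.
Qed.

Lemma subspace_proj W : is_subspace W ->
  exists p : {linear V -> V}, (forall v, W (p v)) /\ forall w, W w -> p w = w.
Proof.
move=> sW; have [A [sA WA WAT]] := subspace_complement sW.
have p v : {w | W w /\ A (v - w)}.
  by apply: cid; have [w [a [Ww Aa ->]]] := WAT v; exists w; rewrite addrC addKr.
have pE v w : W w -> A (v - w) -> sval (p v) = w.
  move=> Ww Avw; case: (p v) => /= u [Wu Avu]; apply/eqP; rewrite -subr_eq0; apply/eqP.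
  apply: WA; first exact: is_subspaceB.
  by have := is_subspaceB sA Avw Avu; rewrite opprB addrC addrA subrK.
have pl : linear (fun v => sval (p v)).
  move=> a u v; case: (svalP (p u)) => Wu Au; case: (svalP (p v)) => Wv Av.
  apply: pE; first exact: sW.2.
  by have := sA.2 a _ _ Au Av; rewrite scalerBr addrACA opprD.
exists (linmap pl); split=> [v|w Ww] /=; first by case: (svalP (p v)).
by apply: pE => //; rewrite subrr; apply: sA.1.
Qed.

Lemma functional_neq0 v : v <> 0 -> exists f : {linear V -> k^o}, f v = 1.
Proof.
move=> v0; pose L : set V := [set w | exists c : k, w = c *: v].
have sL : is_subspace L.
  split=> [|a _ _ [c ->] [d ->]]; first by exists 0; rewrite scale0r.
  by exists (a * c + d); rewrite scalerDl scalerA.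
have [p [Lp pL]] := subspace_proj sL.
have [c cE] := choice Lp.
have inj a b : a *: v = b *: v -> a = b.
  move/eqP; rewrite -subr_eq0 -scalerBl scaler_eq0 => /orP[|/eqP//].
  by rewrite subr_eq0 => /eqP.
have cl : linear (c : V -> k^o).
  by move=> a x y; apply: inj; rewrite scalerDl -scalerA -!cE linearP.
exists (linmap cl); apply: inj; rewrite -cE scale1r; apply: pL.
by exists 1; rewrite scale1r.
Qed.

Lemma functional_separates u v :
  (forall f : {linear V -> k^o}, f u = f v) -> u = v.
Proof.
move=> uv; apply: contrapT => nuv.
have [|f] := @functional_neq0 (u - v); first by move/eqP; rewrite subr_eq0 => /eqP.
by rewrite linearB uv subrr => /eqP; rewrite eq_sym oner_eq0.
Qed.

Lemma functional_notin W v : is_subspace W -> ~ W v ->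
  exists f : {linear V -> k^o}, (forall w, W w -> f w = 0) /\ f v = 1.
Proof.
move=> sW nWv; have [p [Wp pW]] := subspace_proj sW.
have [|f fv] := @functional_neq0 (v - p v).
  by move/eqP; rewrite subr_eq0 => /eqP vp; apply: nWv; rewrite vp.
have ql : linear (fun v => f (v - p v)).
  by move=> a x y; rewrite -linearP /= linearP opprD addrACA scalerBr.
by exists (linmap ql); split=> //= w Ww; rewrite pW// subrr linear0.
Qed.

End Subspaces.

(** * Dimensions of subsets, computed in spaces of row vectors *)

Section FiniteDimension.
Variable k : fieldType.

Lemma dim_rV n : \dim {:'rV[k]_n} = n.
Proof. by rewrite dimvf /dim /= mul1n. Qed.

(** A [vspace] of maximal dimension inside X is all of X, since any further vector of X would
    enlarge it. This makes the dimension theory of [vspace] available for sets. *)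
Lemma subspace_vspace n (X : set 'rV[k]_n) : is_subspace X ->
  exists U : {vspace 'rV[k]_n}, forall v, X v <-> v \in U.
Proof.
move=> sX.
pose P m := `[< exists2 U : {vspace 'rV[k]_n}, \dim U = m & forall v, v \in U -> X v >].
have P0 : exists m, P m.
  exists 0%N; apply/asboolP; exists 0%VS; first exact: dimv0.
  by move=> v; rewrite memv0 => /eqP->; apply: sX.1.
have Pn m : P m -> (m <= n)%N.
  move=> /asboolP[U <- _]; have := dimvS (subvf U).
  by rewrite dim_rV.
have [m /asboolP[U Um UX] mmax] := ex_maxnP P0 Pn.
exists U => v; split=> [Xv|/UX//]; apply: contrapT => nUv.
have : P (\dim (U + <[v]>)).
  apply/asboolP; exists (U + <[v]>)%VS => // w /memv_addP[u Uu [_ /vlineP[c ->] ->]].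
  by rewrite addrC; apply: sX.2 => //; apply: UX.
move=> /mmax; rewrite -Um => dle.
have : (U == U + <[v]>)%VS by rewrite eqEdim addvSl dle.
move=> /eqP UE; apply: nUv; rewrite UE.
by apply: (subvP (addvSr U <[v]>)); apply: memv_line.
Qed.

Variable V : lmodType k.
Implicit Types W X : set V.

Definition lincomb n (e : 'I_n -> V) (c : 'rV[k]_n) : V := \sum_i c 0 i *: e i.

Lemma lincomb_linear n (e : 'I_n -> V) : linear (lincomb e).
Proof.
move=> a c d; rewrite /lincomb scaler_sumr -big_split /=; apply: eq_bigr => i _.
by rewrite !mxE scalerDl scalerA.
Qed.
HB.instance Definition _ n (e : 'I_n -> V) :=
  GRing.isLinear.Build _ _ _ _ (lincomb e) (lincomb_linear e).

Lemma lincomb_delta n (e : 'I_n -> V) i : lincomb e (delta_mx 0 i) = e i.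
Proof.
rewrite /lincomb (bigD1 i)//= mxE !eqxx scale1r big1 ?addr0// => j ji.
by rewrite mxE (negbTE ji) andbF scale0r.
Qed.

Lemma subspace_lincomb W n (e : 'I_n -> V) c :
  is_subspace W -> (forall i, W (e i)) -> W (lincomb e c).
Proof.
by move=> sW We; apply: is_subspace_sum => // i _; apply: is_subspaceZ.
Qed.

Lemma has_dimP W n : is_subspace W -> has_dim W n <->
  exists phi : {linear 'rV[k]_n -> V}, injective phi /\ range phi = W.
Proof.
move=> sW; split=> [[e [We eW]]|[phi [iphi rphi]]].
  exists (lincomb e); split.
    move=> c d cd; have [c0 [_ h]] := eW (lincomb e c) (subspace_lincomb c sW We).
    by rewrite -(h c erefl) -(h d cd).
  apply/seteqP; split=> [_ [c _ <-]|w /eW[c [-> _]]]; first exact: subspace_lincomb.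
  by exists c.
have phiE c : phi c = \sum_i c 0 i *: phi (delta_mx 0 i).
  by rewrite {1}[c]row_sum_delta linear_sum; apply: eq_bigr => i _; rewrite linearZ.
exists (fun i => phi (delta_mx 0 i)); split=> [i|v]; first by rewrite -rphi; exists (delta_mx 0 i).
rewrite -rphi => -[c _ <-]; exists c; split=> [|d]; first exact: phiE.
by rewrite -phiE => /iphi.
Qed.

(** [U :\: K] is a complement of [U :&: K] in U, so phi maps it bijectively onto the image of U. *)
Lemma has_dim_image n (phi : {linear 'rV[k]_n -> V}) (U K : {vspace 'rV[k]_n}) :
  (forall c, c \in K <-> phi c = 0) ->
  has_dim (phi @` [set c | c \in U]) (\dim (U :\: K)).
Proof.
move=> KP; pose b := vbasis (U :\: K); exists (fun i => phi b`_i); split=> [i|].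
  exists b`_i => //=; have : b`_i \in (U :\: K)%VS by rewrite vbasis_mem// mem_nth// size_tuple.
  by apply: subvP; apply: diffvSl.
have sE (c : 'rV[k]_(\dim (U :\: K))) : \sum_i c 0 i *: phi b`_i = phi (\sum_i c 0 i *: b`_i).
  by rewrite linear_sum; apply: eq_bigr => i _; rewrite linearZ.
move=> _ [u /= Uu <-]; have : u \in (U :\: K + U :&: K)%VS by rewrite addv_diff_cap.
move=> /memv_addP[x xD [y yK uE]].
have phiu : phi u = phi x.
  rewrite uE linearD (_ : phi y = 0) ?addr0//; apply/KP.
  by move: yK; rewrite memv_cap => /andP[].
exists (\row_i coord b i x); split.
  rewrite sE phiu [in LHS](coord_vbasis xD); congr (phi _).
  by apply: eq_bigr => i _; rewrite mxE.
move=> d; rewrite sE phiu => xd; apply/rowP => i; rewrite mxE.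
have : x - \sum_i d 0 i *: b`_i \in ((U :\: K) :&: K)%VS.
  rewrite memv_cap; apply/andP; split; last by apply/KP; rewrite linearB xd subrr.
  rewrite rpredB// rpred_sum// => j _; rewrite rpredZ// vbasis_mem// mem_nth//.
  by rewrite size_tuple.
rewrite capv_diff memv0 subr_eq0 => /eqP ->.
by rewrite coord_sum_free// (basis_free (vbasisP _)).
Qed.

End FiniteDimension.

Lemma has_dim_subspace (k : fieldType) (V : lmodType k) (W X : set V) n :
  is_subspace W -> is_subspace X -> has_dim W n -> X `<=` W ->
  exists m, [/\ has_dim X m, (m <= n)%N & m = n -> X = W].
Proof.
move=> sW sX /(has_dimP _ sW)[phi [iphi rphi]] XW.
have sX' : is_subspace (phi @^-1` X).
  by split=> [|a u v Xu Xv]; rewrite /= ?linear0 ?linearP; [apply: sX.1|apply: sX.2].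
have [U UP] := subspace_vspace sX'.
have XE : X = phi @` [set c | c \in U].
  apply/seteqP; split=> [x Xx|_ [c /= /UP Uc <-]//].
  have : W x by apply: XW.
  by rewrite -rphi => -[c _ cx]; exists c => //=; apply/UP; rewrite /= cx.
exists (\dim (U :\: 0)); split.
- rewrite XE; apply: has_dim_image => c; rewrite memv0; split=> [/eqP->|c0].
    by rewrite linear0.
  by apply/eqP/iphi; rewrite c0 linear0.
- have := dimvS (subvf (U :\: 0)); by rewrite dim_rV.
- have -> : (U :\: 0)%VS = U by rewrite -[RHS](addv_diff_cap U 0%VS) capv0 addv0.
  move=> Un; rewrite XE -rphi.
  have -> : U = fullv by apply/eqP; rewrite eqEdim subvf dim_rV Un /=.
  by apply/seteqP; split=> _ [c _ <-]; exists c => //=; rewrite memvf.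
Qed.

(** Rank-nullity. The last clause says that a map with nonzero kernel on W strictly lowers the
    dimension; this drives the induction in [iso_of_extensible]. *)
Lemma has_dim_map (k : fieldType) (V V' : lmodType k) (W : set V) n
    (u : {linear V -> V'}) :
  is_subspace W -> has_dim W n ->
  exists m, [/\ has_dim (u @` W) m, (m <= n)%N & 
     m = n -> forall w, W w -> u w = 0 -> w = 0].
Proof.
move=> sW /(has_dimP _ sW)[phi [iphi rphi]].
pose psi : {linear 'rV[k]_n -> V'} := u \o phi.
have sK : is_subspace [set c | psi c = 0].
  split=> [|a c d c0 d0]; first exact: linear0.
  by rewrite /mkset linearP c0 d0 scaler0 addr0.
have [K KP] := subspace_vspace sK.
have KP' c : c \in K <-> psi c = 0 by split => /KP.
have d := has_dim_image fullv KP'.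
have KE : (\dim K + \dim (fullv :\: K) = n)%N.
  by have := dimv_cap_compl fullv K; rewrite capfv dim_rV.
exists (\dim (fullv :\: K)); split.
- rewrite (_ : u @` W = psi @` [set c | c \in fullv])//.
  rewrite -rphi; apply/seteqP; split.
    by move=> _ [_ [c _ <-] <-]; exists c => //=; rewrite memvf.
  by move=> _ [c _ <-]; exists (phi c) => //; exists c.
- by rewrite -[leqRHS]KE leq_addl.
- move=> E; move: KE; rewrite E -[X in _ = X]add0n => /addIn/eqP.
  rewrite dimv_eq0 => /eqP K0 w; rewrite -rphi => -[c _ <-] uc.
  have : c \in K by apply/KP.
  by rewrite K0 memv0 => /eqP->; rewrite linear0.
Qed.

(** [vdim] chooses some dimension, so its value is known only through uniqueness. Expressing one
    parametrization of W through another gives a row-free matrix, whose rank is at most its number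
    of columns. *)
Lemma has_dim_uniq (k : fieldType) (V : lmodType k) (W : set V) n m :
  is_subspace W -> has_dim W n -> has_dim W m -> n = m.
Proof.
move=> sW.
suff le n' m' : has_dim W n' -> has_dim W m' -> (n' <= m')%N.
  by move=> Wn Wm; apply/eqP; rewrite eqn_leq !le.
move=> /(has_dimP _ sW)[phi [iphi rphi]] /(has_dimP _ sW)[psi [ipsi rpsi]].
have h c : exists d, psi d = phi c.
  have : W (phi c) by rewrite -rphi; exists c.
  by rewrite -rpsi => -[d _ <-]; exists d.
have [f fE] := choice h.
have fl : linear f.
  by move=> a x y; apply: ipsi; rewrite linearP !fE linearP.
pose M := lin1_mx (linmap fl).
have : row_free M.
  apply/row_freeP/row_freeP; rewrite -kermx_eq0; apply/eqP/row_matrixP => i.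
  rewrite row0; apply: iphi; rewrite linear0 -fE.
  have -> : f (row i (kermx M)) = row i (kermx M) *m M by rewrite mul_rV_lin1.
  by rewrite -row_mul mulmx_ker row0 linear0.
by move=> /eqP <-; apply: rank_leq_col.
Qed.

Lemma vdimE (k : fieldType) (V : lmodType k) (W : set V) n :
  is_subspace W -> has_dim W n -> vdim W = n.
Proof.
by move=> sW Wn; apply: xget_unique => // m Wm; apply: (has_dim_uniq sW).
Qed.

Lemma range_subspace (k : fieldType) (U V : lmodType k) (phi : {linear U -> V}) :
  is_subspace (range phi).
Proof.
split; first by exists 0 => //; rewrite linear0.
by move=> a _ _ [c _ <-] [d _ <-]; exists (a *: c + d) => //; rewrite linearP.
Qed.

Lemma finite_dim_range (k : fieldType) (V : lmodType k) n
  (phi : {linear 'rV[k]_n -> V}) : finite_dim (range phi).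
Proof.
have sK : is_subspace [set c | phi c = 0].
  split=> [|a c d c0 d0]; first exact: linear0.
  by rewrite /mkset linearP c0 d0 scaler0 addr0.
have [K KP] := subspace_vspace sK.
exists (\dim (fullv :\: K)).
rewrite (_ : range phi = phi @` [set c | c \in fullv]).
  by apply: has_dim_image => c; split => /KP.
by apply/seteqP; split=> _ [c _ <-]; exists c => //=; rewrite memvf.
Qed.

Lemma finite_dim_subspace (k : fieldType) (V : lmodType k) (W X : set V) :
  is_subspace W -> is_subspace X -> finite_dim W -> X `<=` W -> finite_dim X.
Proof.
move=> sW sX [n Wn] XW; have [m [Xm _ _]] := has_dim_subspace sW sX Wn XW.
by exists m.
Qed.

Lemma lincomb_cat (k : fieldType) (V : lmodType k) m n (e : 'I_m -> V)
    (f : 'I_n -> V) c d :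
  lincomb e c + lincomb f d =
  lincomb (fun i => match fintype.split i with inl i => e i | inr i => f i end) (row_mx c d).
Proof.
rewrite /lincomb big_split_ord /=; congr (_ + _); apply: eq_bigr => i _.
  by rewrite row_mxEl -[lshift n i]/(unsplit (inl i)) unsplitK.
by rewrite row_mxEr -[rshift m i]/(unsplit (inr i)) unsplitK.
Qed.

(** * Comodules as graded modules over the dual algebra *)

Section TensorSeparation.
Variables (k : fieldType) (U V : lmodType k).

Lemma tens_evalE (f : {linear V -> k^o}) (u : U) v :
  tunitr (tmap idfun f (u ⊗ v)) = f v *: u.
Proof. by rewrite tmapE tunitrE. Qed.

(** Induction on the number of terms. If the first v is a combination of the others, its term is
    absorbed into theirs; otherwise a functional that is 1 on it and 0 on the others shows that the
    first u is 0. *)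
Lemma tens_sum_eq0 n (u : 'I_n -> U) (v : 'I_n -> V) :
  (forall f : {linear V -> k^o}, \sum_i f (v i) *: u i = 0) ->
  \sum_i u i ⊗ v i = 0.
Proof.
elim: n u v => [|n IH] u v uv0; first by rewrite big_ord0.
have vl i : v i = lincomb v (delta_mx 0 i) by rewrite lincomb_delta.
pose w i := v (lift ord0 i).
have [[c vE]|nv] := EM (exists c, v ord0 = lincomb w c).
  have -> : \sum_i u i ⊗ v i = \sum_i (c 0 i *: u ord0 + u (lift ord0 i)) ⊗ w i.
    rewrite big_ord_recl /=; under [RHS]eq_bigr => i _ do rewrite tpureDl.
    rewrite big_split /=; congr (_ + _).
    have hl : linear (fun x : V => u ord0 ⊗ x) by move=> a x y; rewrite tpureDr.
    rewrite -[LHS]/(linmap hl (v ord0)) vE linear_sum.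
    by apply: eq_bigr => i _; rewrite linearZ.
  apply: IH => f; rewrite -[RHS](uv0 f) big_ord_recl /=.
  under eq_bigr => i _ do rewrite scalerDr scalerA.
  rewrite big_split /= -scaler_suml; congr (_ *: _ + _).
  by rewrite vE linear_sum; apply: eq_bigr => i _; rewrite linearZ /= mulrC.
have sW : is_subspace (range (lincomb w)).
  split; first by exists 0 => //; rewrite linear0.
  by move=> a _ _ [c _ <-] [d _ <-]; exists (a *: c + d) => //; rewrite linearP.
have [|f [fw fv]] := functional_notin (v := v ord0) sW; first by move=> [c _ cv]; apply: nv; exists c.
have fw0 i : f (v (lift ord0 i)) = 0.
  by apply: fw; exists (delta_mx 0 i) => //; rewrite lincomb_delta.
have u0 : u ord0 = 0.
  have := uv0 f; rewrite big_ord_recl fv scale1r big1 ?addr0// => i _.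
  by rewrite fw0 scale0r.
have pure0 (x : V) : (0 : U) ⊗ x = 0.
  by have := tpureDl 1 (0 : U) 0 x; rewrite scaler0 addr0 scale1r => /esym/eqP;
    rewrite -subr_eq0 addrK => /eqP.
rewrite big_ord_recl u0 pure0 add0r; apply: IH => f'.
by rewrite -[RHS](uv0 f') big_ord_recl u0 scaler0 add0r.
Qed.

Lemma tens_eq0 (t : tens U V) :
  (forall f : {linear V -> k^o}, tunitr (tmap idfun f t) = 0) -> t = 0.
Proof.
rewrite (tens_sum t); move: (repr t) => s t0.
pose n := size s; pose x0 : U * V := (0, 0).
have sE (W : nmodType) (F : U * V -> W) : \sum_(p <- s) F p = \sum_(i < n) F (nth x0 s i).
  by rewrite (big_nth x0) big_mkord.
rewrite sE; apply: tens_sum_eq0 => f; rewrite -[RHS](t0 f) sE.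
pose ev : {linear tens U V -> U} := @tunitr k U \o tmap idfun f.
rewrite -[RHS]/(ev _) linear_sum; apply: eq_bigr => i _.
by rewrite /ev [RHS]/= tens_evalE.
Qed.

(** This turns the spans in the definition of subcomodules into closure under the action of
    functionals. *)
Lemma tens_evalP (W : set U) (t : tens U V) : is_subspace W ->
  Defs.span [set t | exists u c, W u /\ t = u ⊗ c] t <->
  forall f : {linear V -> k^o}, W (tunitr (tmap idfun f t)).
Proof.
move=> sW; split=> [st f|tW].
  pose Q := [set y : tens U V | W (tunitr (tmap idfun f y))].
  have sQ : is_subspace Q.
    by split=> [|a y z]; rewrite /Q /= ?linear0 ?linearP; [apply: sW.1 | apply: sW.2].
  apply: (span_sub sQ _ st) => _ [u [c [Wu ->]]].
  by rewrite /Q /= tens_evalE; apply: is_subspaceZ.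
have [p [Wp pW]] := subspace_proj sW.
have ql : linear (fun u => u - p u).
  by move=> a x y; rewrite linearP opprD addrACA scalerBr.
pose q := linmap ql.
have tE (y : tens U V) : y = tmap p idfun y + tmap q idfun y.
  have sl : linear (fun y : tens U V => tmap p idfun y + tmap q idfun y).
    by move=> a x z; rewrite !linearP /= addrACA scalerDr.
  rewrite -[LHS]/(idfun y) -[RHS]/(linmap sl y); apply: tens_ext => u v.
  by rewrite /= !tmapE /= -[p u ⊗ v]scale1r -tpureDl scale1r addrC subrK.
(* Every functional evaluates the component along q to q of an element of W, that is, to 0. *)
have -> : t = tmap p idfun t.
  rewrite {1}(tE t) (_ : tmap q idfun t = 0) ?addr0//; apply: tens_eq0 => f.
  have -> : tunitr (tmap idfun f (tmap q idfun t)) = q (tunitr (tmap idfun f t)).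
    pose f1 : {linear tens U V -> U} := (@tunitr k U \o tmap idfun f) \o tmap q idfun.
    pose g1 : {linear tens U V -> U} := q \o (@tunitr k U \o tmap idfun f).
    rewrite -[LHS]/(f1 t) -[RHS]/(g1 t); apply: tens_ext => u v.
    by rewrite /f1 /g1 /= !tmapE !tunitrE /= linearZ scalerBr.
  by rewrite /= pW ?subrr.
pose tp : {linear tens U V -> tens U V} := tmap p idfun.
rewrite (tens_sum t) -[tmap _ _ _]/(tp _) linear_sum; apply: is_subspace_sum => [|y _].
  exact: span_subspace.
by rewrite /tp /= tmapE; apply: Defs.sub_span; exists (p y.1), y.2.
Qed.

End TensorSeparation.

(** * Even and odd components as linear projections *)

Section GradedProjections.
Variables (k : fieldType) (V : gspace k).

Let gproj_ex (v : V) :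
  exists w : bool -> V, (forall b, gpart b (w b)) /\ v = w false + w true.
Proof.
have [v0 [v1 [h0 h1 ->]]] := gpart_sum v.
by exists (fun b => if b then v1 else v0); split=> // -[].
Qed.

Let gproj_fun b v := sval (cid (gproj_ex v)) b.

Let gproj_part b v : gpart b (gproj_fun b v).
Proof. by rewrite /gproj_fun; case: cid => w []. Qed.

Let gproj_sum v : v = gproj_fun false v + gproj_fun true v.
Proof. by rewrite /gproj_fun; case: cid => w []. Qed.

Lemma gpart_disjoint b (v : V) : gpart b v -> gpart (~~ b) v -> v = 0.
Proof. by case: b => ? ?; apply: gpart_direct. Qed.

Let gproj_uniq v v0 v1 : gpart false v0 -> gpart true v1 -> v = v0 + v1 ->
  gproj_fun false v = v0 /\ gproj_fun true v = v1.
Proof.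
move=> h0 h1 vE; set w := gproj_fun.
have E : w false v - v0 = v1 - w true v.
  apply/eqP; rewrite subr_eq addrAC [v1 + v0]addrC -vE eq_sym subr_eq; apply/eqP.
  exact: gproj_sum.
have w0 : w false v - v0 = 0.
  apply: gpart_direct; last rewrite E; apply: is_subspaceB => //; try exact: gpart_subspace;
    exact: gproj_part.
by split; apply/eqP; rewrite -subr_eq0 -?[_ - v1]opprB -?E w0 ?oppr0.
Qed.

Let gproj_linear b : linear (gproj_fun b).
Proof.
move=> a u v; have S g := (gpart_subspace V g).2 a.
have [|h0 h1] := @gproj_uniq (a *: u + v) _ _
  (S false _ _ (gproj_part false u) (gproj_part false v))
  (S true _ _ (gproj_part true u) (gproj_part true v)).
  by rewrite addrACA -scalerDr -!gproj_sum.
by case: b.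
Qed.

Definition gproj b : {linear V -> V} := linmap (gproj_linear b).

Lemma gprojP b v : gpart b (gproj b v).
Proof. exact: gproj_part. Qed.

Lemma gprojD v : v = gproj false v + gproj true v.
Proof. exact: gproj_sum. Qed.

Lemma gprojDb b v : v = gproj b v + gproj (~~ b) v.
Proof. by case: b; rewrite {1}(gprojD v) // addrC. Qed.

Lemma gproj_id b v : gpart b v -> gproj b v = v.
Proof.
have P0 g := (gpart_subspace V g).1.
by case: b => vb; [have [] := @gproj_uniq v 0 v|have [] := @gproj_uniq v v 0];
  rewrite ?add0r ?addr0.
Qed.

Lemma gproj_out b v : gpart b v -> gproj (~~ b) v = 0.
Proof.
move=> vb; apply: (@gpart_disjoint b); last exact: gprojP.
have := congr1 (fun x => x - v) (gprojDb b v).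
by rewrite (gproj_id vb) subrr addrAC subrr add0r => <-; apply: (gpart_subspace _ _).1.
Qed.

Lemma gproj_idem b v : gproj b (gproj b v) = gproj b v.
Proof. exact: gproj_id (gprojP _ _). Qed.

Lemma gproj_tf v : gproj true (gproj false v) = 0.
Proof. exact: gproj_out (gprojP _ _). Qed.

Lemma gproj_ft v : gproj false (gproj true v) = 0.
Proof. exact: gproj_out (gprojP _ _). Qed.

End GradedProjections.

Section Action.
Variables (k : fieldType) (C : gcoalgebra k).
Implicit Types (V M W : comodule C) (f g : {linear C -> k^o}).

(* The rational left action of the dual algebra C^*: f.v is the sum of the
   f(v_(1)) v_(0). *)
Definition act V f : {linear V -> V} :=
  (@tunitr k V \o tmap idfun f) \o coact V.

Lemma actE V f v : act V f v = tunitr (tmap idfun f (coact V v)).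
Proof. by []. Qed.

(** The convolution product of the dual algebra, in the order that makes [act] a left action. *)
Definition conv f g : {linear C -> k^o} := (@tunitl k k^o \o tmap f g) \o comul C.

Lemma act_conv V f g v : act V f (act V g v) = act V (conv f g) v.
Proof.
pose F : {linear tens V C -> V} := (@tunitr k V \o tmap idfun g).
pose T : {linear tens (tens V C) C -> V} :=
  (@tunitr k V \o tmap idfun (@tunitl k k^o \o tmap f g)) \o (@tassoc k V C C).
have TE (t : tens V C) : T (tmap (coact V) idfun t) = act V f (F t).
  pose h1 : {linear tens V C -> V} := T \o tmap (coact V) idfun.
  pose h2 : {linear tens V C -> V} := act V f \o F.
  rewrite -[LHS]/(h1 t) -[RHS]/(h2 t); apply: tens_ext => u c.
  rewrite /h1 /h2 /F /= !tmapE tunitrE !linearZ /=.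
  have lc : linear (fun y : tens V C => y ⊗ c) by move=> a y z; rewrite tpureDl.
  pose e1 : {linear tens V C -> V} := T \o linmap lc.
  pose e2 : {linear tens V C -> V} := g c \*: (@tunitr k V \o tmap idfun f).
  rewrite -[LHS]/(e1 _) -[RHS]/(e2 _); apply: tens_ext => w d.
  by rewrite /e1 /e2 /T /= tassocE !tmapE /= tmapE !tunitrE tunitlE scalerA mulrC.
rewrite -[LHS]/(act V f (F (coact V v))) -TE /T /= coactA.
pose h1 : {linear tens V C -> V} :=
  (@tunitr k V \o tmap idfun (@tunitl k k^o \o tmap f g)) \o tmap idfun (comul C).
pose h2 : {linear tens V C -> V} := @tunitr k V \o tmap idfun (conv f g).
rewrite -[LHS]/(h1 _) -[RHS]/(h2 _); apply: tens_ext => u c.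
by rewrite /h1 /h2 /= !tmapE !tunitrE.
Qed.

Lemma act_counit V v : act V (counit C) v = v.
Proof. exact: coact_counit. Qed.

Lemma conv_act f g c : conv f g c = f (act (regular_comodule C) g c).
Proof.
pose h1 : {linear tens C C -> k^o} := @tunitl k k^o \o tmap f g.
pose h2 : {linear tens C C -> k^o} := f \o (@tunitr k C \o tmap idfun g).
rewrite -[LHS]/(h1 (comul C c)) -[RHS]/(h2 (comul C c)); apply: tens_ext => a b.
by rewrite /h1 /h2 /= !tmapE tunitrE tunitlE linearZ; apply: mulrC.
Qed.

(** Left counitality. It recovers f(c) from the counit of the translate f.c, which is why a comodule
    map to C is determined by its composite with the counit. *)
Lemma counit_act f c : counit C (act (regular_comodule C) f c) = f c.
Proof.
rewrite -conv_act -[in RHS](counitl c).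
pose h1 : {linear tens C C -> k^o} := @tunitl k k^o \o tmap (counit C) f.
pose h2 : {linear tens C C -> k^o} := f \o (@tunitl k C \o tmap (counit C) idfun).
rewrite -[LHS]/(h1 (comul C c)) -[RHS]/(h2 (comul C c)); apply: tens_ext => a b.
by rewrite /h1 /h2 /= !tmapE !tunitlE linearZ.
Qed.

(** Functionals on the right factor separate the elements of W ⊗ C, so compatibility with the
    coactions can be tested on one functional at a time. *)
Lemma coact_hom_act V W (h : {linear V -> W}) :
  (forall v, coact W (h v) = tmap h idfun (coact V v)) <->
  (forall f v, h (act V f v) = act W f (h v)).
Proof.
have hE (f : {linear C -> k^o}) (t : tens V C) :
    h (tunitr (tmap idfun f t)) = tunitr (tmap idfun f (tmap h idfun t)).
  pose h1 : {linear tens V C -> W} := h \o (@tunitr k V \o tmap idfun f).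
  pose h2 : {linear tens V C -> W} := (@tunitr k W \o tmap idfun f) \o tmap h idfun.
  rewrite -[LHS]/(h1 t) -[RHS]/(h2 t); apply: tens_ext => u c.
  by rewrite /h1 /h2 /= !tmapE !tunitrE linearZ.
split=> [hc f v|hf v]; first by rewrite actE hE -hc.
apply/eqP; rewrite -subr_eq0; apply/eqP; apply: tens_eq0 => f.
pose ev : {linear tens W C -> W} := @tunitr k W \o tmap idfun f.
by rewrite -[LHS]/(ev _) linearB /ev /= -hE -!actE hf subrr.
Qed.

Lemma ungraded_subcomodP V (W : set V) : is_ungraded_subcomod W <->
  is_subspace W /\ forall f w, W w -> W (act V f w).
Proof.
split=> -[sW cW]; split=> //.
  by move=> f w Ww; rewrite actE; apply: ((tens_evalP _ sW).1 (cW w Ww)).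
by move=> w Ww; apply: ((tens_evalP _ sW).2 _) => f; apply: cW.
Qed.

Lemma is_subcomodP V (W : set V) : is_subcomod W <->
  [/\ is_subspace W, forall f w, W w -> W (act V f w) &
      forall b w, W w -> W (gproj V b w)].
Proof.
split=> [[/ungraded_subcomodP[sW aW] gW]|[sW aW gW]].
  split=> // b w /gW[w0 [w1 [[g0 W0] [g1 W1] ->]]]; rewrite linearD.
  case: b; first by rewrite (gproj_out (b := false) g0) (gproj_id g1) add0r.
  by rewrite (gproj_out (b := true) g1) (gproj_id g0) addr0.
split; first by apply/ungraded_subcomodP.
move=> w Ww; exists (gproj V false w), (gproj V true w).
by split; [split; [apply: gprojP|apply: gW]..|apply: gprojD].
Qed.

(** In [coact v] the degrees of the two factors add up to g, and only the terms whose right factor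
    has degree b survive f. *)
Lemma act_part V b (g : bool) v f : (forall c, gpart (~~ b) c -> f c = 0) ->
  gpart g v -> gpart (b (+) g) (act V f v).
Proof.
move=> fb vg; rewrite actE.
have sP := gpart_subspace V (b (+) g).
pose ev : {linear tens V C -> V} := @tunitr k V \o tmap idfun f.
pose Q := [set y : tens V C | gpart (b (+) g) (ev y)].
have sQ : is_subspace Q.
  by split=> [|a y z]; rewrite /Q /= ?linear0 ?linearP; [apply: sP.1 | apply: sP.2].
apply: (span_sub sQ _ (coact_deg0 vg)) => _ [a [d [u [c [adg ua cd ->]]]]].
rewrite /Q /ev /= tens_evalE.
have [bd|] := eqVneq d b; last first.
  move=> db; rewrite fb ?scale0r; first exact: sP.1.
  by move: db cd; case: (b); case: (d).
by apply: is_subspaceZ => //; rewrite -adg bd addbCA addbb addbF.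
Qed.

Definition fproj f b : {linear C -> k^o} := f \o gproj C b.

Lemma fprojP f b c : gpart (~~ b) c -> fproj f b c = 0.
Proof.
by move=> /gproj_out; rewrite negbK /fproj /= => ->; apply: linear0.
Qed.

Lemma act_fproj V f v : act V f v = act V (fproj f false) v + act V (fproj f true) v.
Proof.
pose h1 : {linear tens V C -> V} := @tunitr k V \o tmap idfun f.
pose h2 : {linear tens V C -> V} :=
  (@tunitr k V \o tmap idfun (fproj f false)) \+ (@tunitr k V \o tmap idfun (fproj f true)).
rewrite -[LHS]/(h1 (coact V v)) -[RHS]/(h2 (coact V v)); apply: tens_ext => a b.
by rewrite /h1 /h2 /= !tmapE !tunitrE [in LHS](gprojD b) linearD scalerDl.
Qed.

Lemma gproj_act_fproj V f b (g : bool) v :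
  gproj V (b (+) g) (act V (fproj f b) v) = act V (fproj f b) (gproj V g v).
Proof.
rewrite {1}(gprojDb g v) !linearD.
rewrite (gproj_id (act_part (@fprojP f b) (gprojP g v))) -[b (+) g]negbK -addbN.
by rewrite (gproj_out (act_part (@fprojP f b) (gprojP (~~ g) v))) addr0.
Qed.

Lemma gproj_act V f b v : gproj V b (act V f v) =
  act V (fproj f false) (gproj V b v) + act V (fproj f true) (gproj V (~~ b) v).
Proof.
(* b is written as [false (+) b] for the even part of f and as [true (+) ~~ b] for the odd part. *)
rewrite act_fproj linearD -[X in X + _ = _]/(gproj V (false (+) b) _) gproj_act_fproj.
by rewrite -[b in X in _ + X = _]negbK -[~~ ~~ b]/(true (+) ~~ b) gproj_act_fproj.
Qed.

Section Cofree.
Variables (V : comodule C) (l : {linear V -> k^o}).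

(* v |-> l(v_(0)) v_(1), the map to C with counit component l. *)
Definition cofun : {linear V -> C} := (@tunitl k C \o tmap l idfun) \o coact V.

(** Both sides are the sum of the l(v_(0)) f(v_(1)). As functionals separate points, this formula
    determines [cofun], and the properties below follow from it. *)
Lemma functional_cofun f v : f (cofun v) = l (act V f v).
Proof.
pose h1 : {linear tens V C -> k^o} := f \o (@tunitl k C \o tmap l idfun).
pose h2 : {linear tens V C -> k^o} := l \o (@tunitr k V \o tmap idfun f).
rewrite -[LHS]/(h1 (coact V v)) -[RHS]/(h2 (coact V v)); apply: tens_ext => a b.
by rewrite /h1 /h2 /= !tmapE tunitrE tunitlE !linearZ; apply: mulrC.
Qed.

Lemma cofun_act f v : cofun (act V f v) = act (regular_comodule C) f (cofun v).
Proof.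
apply: functional_separates => g; rewrite functional_cofun act_conv.
by rewrite -functional_cofun conv_act.
Qed.

Lemma counit_cofun v : counit C (cofun v) = l v.
Proof. by rewrite functional_cofun act_counit. Qed.

Lemma cofun_part b : (forall v, gpart (~~ b) v -> l v = 0) ->
  forall (g : bool) v, gpart g v -> @gpart _ C (b (+) g) (cofun v).
Proof.
move=> lb g v vg.
(* Functionals detecting the unwanted component have degree [~~ (b (+) g)]; they move v into degree
   [~~ b], where l vanishes. *)
suff E : gproj C (~~ (b (+) g)) (cofun v) = 0.
  by rewrite (gprojDb (b (+) g) (cofun v)) E addr0; apply: gprojP.
apply: functional_separates => f; rewrite linear0.
rewrite -[LHS]/(fproj f (~~ (b (+) g)) (cofun v)) functional_cofun; apply: lb.
have := act_part (@fprojP f (~~ (b (+) g))) vg.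
by rewrite -addNb -addbA addbb addbF.
Qed.

End Cofree.

End Action.

(** * Homogeneous maps on subcomodules, and local finiteness *)

Section PartialHoms.
Variables (k : fieldType) (C : gcoalgebra k).
Implicit Types (V M W : comodule C) (f g : {linear C -> k^o}).

(* Comodule maps of degree b defined on a subset X of V: their values outside
   X are irrelevant. *)
Definition phom (b : bool) V M (X : set V) (h : V -> M) : Prop :=
  [/\ forall a u v, X u -> X v -> h (a *: u + v) = a *: h u + h v,
      forall f v, X v -> h (act V f v) = act M f (h v) &
      forall (g : bool) v, X v -> gpart g v -> gpart (b (+) g) (h v)].

Lemma comod_homP V M (h : {linear V -> M}) :
  comod_hom h <-> phom false [set: V] h.
Proof.
split=> [[hg /coact_hom_act hc]|[_ hc hg]].
  by split=> [a u v _ _|f v _|g v _]; [rewrite linearP|apply: hc|apply: hg].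
by split=> [g v|]; [apply: hg|apply/coact_hom_act => f v; apply: hc].
Qed.

Lemma phom_cofun b V (l : {linear V -> k^o}) :
  (forall v, gpart (~~ b) v -> l v = 0) ->
  phom (M := regular_comodule C) b [set: V] (cofun l).
Proof.
move=> lb; split=> [a u v _ _|f v _|g v _]; first by rewrite linearP.
- exact: cofun_act.
- exact: cofun_part.
Qed.

Lemma phom_sub b V M (X Y : set V) (h : V -> M) :
  X `<=` Y -> phom b Y h -> phom b X h.
Proof.
move=> XY [h1 h2 h3]; split=> [a u v /XY Xu /XY Xv|f v /XY Xv|g v /XY Xv].
- exact: h1.
- exact: h2.
- exact: h3.
Qed.

Lemma phom_comp b c V M W (X : set V) (Y : set M) (h : V -> M) (h' : M -> W) :
  (forall v, X v -> Y (h v)) -> phom b X h -> phom c Y h' ->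
  phom (b (+) c) X (h' \o h).
Proof.
move=> XY [h1 h2 h3] [h1' h2' h3']; split=> [a u v Xu Xv|f v Xv|g v Xv gv] /=.
- by rewrite h1// h1'//; apply: XY.
- by rewrite h2// h2'//; apply: XY.
- by rewrite [b (+) c]addbC -addbA; apply: h3'; [apply: XY|apply: h3].
Qed.

Lemma phom_shift b V M (X : set V) (h : V -> M) :
  phom b X h <-> phom (M := shift M) (~~ b) X h.
Proof.
by split=> -[h1 h2 h3]; split=> // g v Xv /(h3 _ _ Xv); rewrite /= addNb negbK.
Qed.

Section OnSubcomodule.
Variables (b : bool) (V M : comodule C) (X : set V) (h : V -> M).
Hypotheses (sX : is_subcomod X) (hX : phom b X h).

Let sX' : is_subspace X. Proof. by case/is_subcomodP: sX. Qed.

Lemma phomB u v : X u -> X v -> h (u - v) = h u - h v.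
Proof.
case: hX => h1 _ _ Xu Xv; rewrite addrC -scaleN1r h1// scaleN1r addrC//.
Qed.

Lemma phom0 : h 0 = 0.
Proof. by rewrite -[in LHS](subrr 0) phomB ?subrr//; apply: sX'.1. Qed.

Lemma phomZ a u : X u -> h (a *: u) = a *: h u.
Proof.
case: hX => h1 _ _ Xu; rewrite -[a *: u]addr0 h1// ?phom0 ?addr0//.
exact: sX'.1.
Qed.

Lemma phomD u v : X u -> X v -> h (u + v) = h u + h v.
Proof. by case: hX => h1 _ _ Xu Xv; rewrite -[u]scale1r h1// !scale1r. Qed.

Lemma phom_lincomb n (e : 'I_n -> V) c :
  (forall i, X (e i)) -> h (lincomb e c) = lincomb (h \o e) c.
Proof.
move=> Xe; have [] : X (lincomb e c) /\ h (lincomb e c) = lincomb (h \o e) c; last by [].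
rewrite /lincomb; elim/big_ind2: _ => [|u u' v v' [Xu <-] [Xv <-]|i _].
- by rewrite phom0; split=> //; apply: sX'.1.
- by rewrite phomD//; split=> //; apply: is_subspaceD.
- by rewrite phomZ//; split=> //; apply: is_subspaceZ.
Qed.

Lemma phom_gproj (g : bool) v : X v -> h (gproj V g v) = gproj M (b (+) g) (h v).
Proof.
case/is_subcomodP: sX => _ _ gX; case: hX => _ _ h3 Xv.
rewrite [in RHS](gprojDb g v) phomD ?linearD; try exact: gX.
rewrite (gproj_id (h3 _ _ (gX g v Xv) (gprojP g v))) -[b (+) g]negbK -addbN.
by rewrite (gproj_out (h3 _ _ (gX _ v Xv) (gprojP (~~ g) v))) addr0.
Qed.

Lemma phom_image : is_subcomod (h @` X).
Proof.
case/is_subcomodP: (sX) => _ aX gX; case: hX => h1 h2 h3; apply/is_subcomodP; split.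
- split=> [|a _ _ [u Xu <-] [v Xv <-]]; first by exists 0; [apply: sX'.1|apply: phom0].
  by exists (a *: u + v); [apply: sX'.2|apply: h1].
- by move=> f _ [v Xv <-]; exists (act V f v); [apply: aX|apply: h2].
- move=> g _ [v Xv <-]; exists (gproj V (b (+) g) v); first exact: gX.
  by rewrite phom_gproj// addbA addbb addFb.
Qed.

Lemma phom_ker : is_subcomod [set v | X v /\ h v = 0].
Proof.
case/is_subcomodP: (sX) => _ aX gX; case: hX => h1 h2 h3; apply/is_subcomodP; split.
- split=> [|a u v [Xu u0] [Xv v0]]; first by split; [apply: sX'.1|apply: phom0].
  by split; [apply: sX'.2|rewrite h1// u0 v0 scaler0 addr0].
- by move=> f v [Xv v0]; split; [apply: aX|rewrite h2// v0 linear0].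
- by move=> g v [Xv v0]; split; [apply: gX|rewrite phom_gproj// v0 linear0].
Qed.

Lemma phom_inj : (forall v, X v -> h v = 0 -> v = 0) ->
  forall u v, X u -> X v -> h u = h v -> u = v.
Proof.
move=> h0 u v Xu Xv uv; apply/eqP; rewrite -subr_eq0; apply/eqP; apply: h0.
  exact: is_subspaceB.
by rewrite phomB// uv subrr.
Qed.

(** The inverse has degree b again because b (+) b is even; preimages of homogeneous elements are
    homogeneous since h commutes with the projections up to the degree shift. *)
Lemma phom_inverse : (forall v, X v -> h v = 0 -> v = 0) ->
  exists h' : M -> V, [/\ phom b (h @` X) h', forall v, X v -> h' (h v) = v &
    forall w, (h @` X) w -> X (h' w) /\ h (h' w) = w].
Proof.
move=> h0; have hI := phom_inj h0.
have ex w : exists v, (h @` X) w -> X v /\ h v = w.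
  by have [[v Xv vw]|nw] := EM ((h @` X) w); [exists v|exists 0].
have [h' h'P] := choice ex.
have h'K v : X v -> h' (h v) = v.
  move=> Xv; have [] := h'P (h v); first by exists v.
  by move=> Xh' /hI; apply.
case/is_subcomodP: (sX) => _ aX gX; case: hX => h1 h2 h3.
exists h'; split=> //; split.
- by move=> a _ _ [u Xu <-] [v Xv <-]; rewrite -h1// !h'K//; apply: sX'.2.
- by move=> f _ [v Xv <-]; rewrite -h2// !h'K//; apply: aX.
- move=> g _ [v Xv <-] gv; rewrite h'K//.
  rewrite (_ : v = gproj V (b (+) g) v); first exact: gprojP.
  apply: hI => //; first exact: gX.
  by rewrite phom_gproj// addbA addbb addFb gproj_id.
Qed.

End OnSubcomodule.

Lemma subcomodI V (X Y : set V) : is_subcomod X -> is_subcomod Y -> is_subcomod (X `&` Y).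
Proof.
move=> /is_subcomodP[sX aX gX] /is_subcomodP[sY aY gY]; apply/is_subcomodP; split.
- exact: is_subspaceI.
- by move=> f v [Xv Yv]; split; [apply: aX|apply: aY].
- by move=> b v [Xv Yv]; split; [apply: gX|apply: gY].
Qed.

Lemma subcomodT V : is_subcomod [set: V].
Proof. by apply/is_subcomodP. Qed.

Lemma subcomod_subspace V (X : set V) : is_subcomod X -> is_subspace X.
Proof. by case/is_subcomodP. Qed.

(** The coaction of v is a finite sum of terms e_i ⊗ c_i, so the e_i span a space containing all
    translates of v, whatever f is. *)
Lemma act_finite V (v : V) : exists n (e : 'I_n -> V) (c : 'I_n -> C),
  forall f, act V f v = lincomb e (\row_i f (c i)).
Proof.
pose s := repr (coact V v); pose x0 : V * C := (0, 0).
exists (size s), (fun i => (nth x0 s i).1), (fun i => (nth x0 s i).2) => f.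
rewrite actE; pose ev : {linear tens V C -> V} := @tunitr k V \o tmap idfun f.
rewrite -[LHS]/(ev _) (tens_sum (coact V v)) linear_sum (big_nth x0) big_mkord.
by apply: eq_bigr => i _; rewrite mxE /ev /= tens_evalE.
Qed.

Definition flin a f g : {linear C -> k^o} := a \*: f \+ g.

Lemma act_flin V a f g (v : V) : act V (flin a f g) v = a *: act V f v + act V g v.
Proof.
pose h1 : {linear tens V C -> V} := @tunitr k V \o tmap idfun (flin a f g).
pose h2 : {linear tens V C -> V} :=
  (a \*: (@tunitr k V \o tmap idfun f)) \+ (@tunitr k V \o tmap idfun g).
rewrite -[LHS]/(h1 (coact V v)) -[RHS]/(h2 (coact V v)); apply: tens_ext => u c.
by rewrite /h1 /h2 /= !tmapE !tunitrE /= scalerDl scalerA.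
Qed.

Lemma subcomod_locally_finite V (X : set V) v : is_subcomod X -> X v ->
  exists Y, [/\ is_subcomod Y, finite_dim Y, Y `<=` X & Y v].
Proof.
move=> /is_subcomodP[sX aX gX] Xv.
(* The submodule generated by the two homogeneous components of v; generating from v itself need not
   give a graded subspace. *)
pose Y : set V :=
  [set w | exists f : {linear C -> k^o} * {linear C -> k^o}, w = act V f.1 (gproj V false v) + act V f.2 (gproj V true v)].
have sY : is_subspace Y.
  split=> [|a _ _ [f ->] [g ->]].
    (* The zero functional, written as a difference. *)
    exists (flin (-1) (counit C) (counit C), flin (-1) (counit C) (counit C)).
    by rewrite !act_flin !scaleN1r !addNr addr0.
  exists (flin a f.1 g.1, flin a f.2 g.2).
  by rewrite !act_flin addrACA scalerDr.
exists Y; split=> //.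
- apply/is_subcomodP; split=> // [f _ [g ->]|b _ [g ->]].
    by exists (conv f g.1, conv f g.2); rewrite linearD !act_conv.
  (* Degree b is reached from the even component by functionals of degree b, and from the odd one by
     those of degree [~~ b]. *)
  exists (fproj g.1 b, fproj g.2 (~~ b)); rewrite linearD !gproj_act.
  by case: b; rewrite !(gproj_idem, gproj_tf, gproj_ft, linear0, add0r, addr0).
- have [n0 [e0 [c0 E0]]] := act_finite (gproj V false v).
  have [n1 [e1 [c1 E1]]] := act_finite (gproj V true v).
  apply: (@finite_dim_subspace _ _ (range (lincomb
    (fun i => match fintype.split i with inl i => e0 i | inr i => e1 i end)))).
  + exact: range_subspace.
  + exact: sY.
  + exact: finite_dim_range.
  by move=> _ [f ->]; rewrite E0 E1 lincomb_cat; eexists.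
- by move=> _ [f ->]; apply: is_subspaceD => //; apply: aX; apply: gX.
- by exists (counit C, counit C); rewrite !act_counit -gprojD.
Qed.

End PartialHoms.

(** * Simple and extensible comodules *)

Section Simple.
Variables (k : fieldType) (C : gcoalgebra k).
Implicit Types (V M W : comodule C).

Lemma simpleW V (T : set V) : simple_subcomod T -> is_subcomod T.
Proof. by case. Qed.

Lemma simple_neq0 V (T : set V) : simple_subcomod T -> exists2 v, T v & v <> 0.
Proof. by move=> [/subcomod_subspace sT T0 _]; apply: subspace_neq0. Qed.

Lemma simple_sub V (T X : set V) v : simple_subcomod T -> is_subcomod X ->
  X `<=` T -> X v -> v <> 0 -> X = T.
Proof.
move=> [_ _ Tmin] sX XT Xv v0; case: (Tmin _ sX XT) => // X0.
by move: Xv; rewrite X0 => /v0.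
Qed.

Lemma simple_phom_inj b V M (T : set V) (h : V -> M) v :
  simple_subcomod T -> phom b T h -> T v -> h v <> 0 ->
  forall u, T u -> h u = 0 -> u = 0.
Proof.
move=> sT hT Tv hv u Tu hu; apply: contrapT => u0; apply: hv.
have K : [set v | T v /\ h v = 0] = T.
  apply: (simple_sub sT _ _ _ u0); first exact: phom_ker (simpleW sT) hT.
    by move=> w [].
  by [].
by have : T v by []; rewrite -K => -[].
Qed.

Lemma simple_image b V M (T : set V) (h : V -> M) v :
  simple_subcomod T -> phom b T h -> T v -> h v <> 0 -> simple_subcomod (h @` T).
Proof.
move=> sT hT Tv hv; case: (sT) => sT' _ Tmin; split.
- exact: phom_image sT' hT.
- move=> E; apply: hv; have : (h @` T) (h v) by exists v.
  by rewrite E.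
move=> X sX XT.
have [h' [hh' h'K hK']] := phom_inverse sT' hT (simple_phom_inj sT hT Tv hv).
have hX := phom_sub XT hh'.
have [|h'X0|h'X] := Tmin _ (phom_image sX hX).
- by move=> _ [x Xx <-]; apply: (hK' _ (XT _ Xx)).1.
- left; apply/seteqP; split=> [x Xx|_ ->]; last exact: (subcomod_subspace sX).1.
  have h'x : h' x = 0 by have : (h' @` X) (h' x) by [exists x]; rewrite h'X0.
  by rewrite /set1 /mkset -(hK' _ (XT _ Xx)).2 h'x (phom0 sT' hT).
- right; apply/seteqP; split=> // _ [t Tt <-].
  move: Tt; rewrite -h'X => -[x Xx <-].
  by rewrite (hK' _ (XT _ Xx)).2.
Qed.

Lemma simple_finite V (T : set V) : simple_subcomod T -> finite_dim T.
Proof.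
move=> sT; have [v Tv v0] := simple_neq0 sT.
have [Y [sY fY YT Yv]] := subcomod_locally_finite (simpleW sT) Tv.
by rewrite -(simple_sub sT sY YT Yv v0).
Qed.

(** By local finiteness X contains nonzero finite-dimensional subcomodules; one of least dimension
    is simple. *)
Lemma exists_simple V (X : set V) v : is_subcomod X -> X v -> v <> 0 ->
  exists2 T, simple_subcomod T & T `<=` X.
Proof.
move=> sX Xv v0.
pose P n := `[< exists Y, [/\ is_subcomod Y, has_dim Y n, Y `<=` X & exists2 w, Y w & w <> 0] >].
have [|n /asboolP[Y [sY Yn YX [w Yw w0]]] nmin] := @ex_minnP P.
  have [Y [sY [n Yn] YX Yv]] := subcomod_locally_finite sX Xv.
  by exists n; apply/asboolP; exists Y; split=> //; exists v.
exists Y => //; split=> // [Y0|Z sZ ZY]; first by move: Yw; rewrite Y0.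
have [|Z0] := EM (Z = [set 0]); first by left.
right; have [m [Zm mn mE]] := has_dim_subspace (subcomod_subspace sY) (subcomod_subspace sZ) Yn ZY.
apply: mE; apply/eqP; rewrite eqn_leq mn nmin//.
apply/asboolP; exists Z; split=> //; first by move=> z /ZY/YX.
exact: subspace_neq0 (subcomod_subspace sZ) Z0.
Qed.

Lemma simple_sub_socle V (T : set V) : simple_subcomod T -> T `<=` socle V.
Proof.
move=> sT; apply: sub_socle; exists [set T]; first by move=> _ ->.
rewrite bigcup_set1; apply/seteqP; split; first exact: Defs.sub_span.
by apply: span_sub => //; apply: subcomod_subspace (simpleW sT).
Qed.

(** The image is simple, hence contained in the socle, which is itself simple. *)
Lemma simple_image_socle b V M (T : set V) (h : V -> M) v :
  simple_subcomod (@socle k C M) -> simple_subcomod T -> phom b T h ->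
  T v -> h v <> 0 -> h @` T = socle M.
Proof.
move=> sM sT hT Tv hv; have sh := simple_image sT hT Tv hv.
have [w hw w0] := simple_neq0 sh.
exact: (simple_sub sM (simpleW sh) (simple_sub_socle sh) hw w0).
Qed.

End Simple.

(** On the finite-dimensional T the endomorphism p^-1 q has an eigenvalue a. Then q - a p is
    homogeneous with nonzero kernel on T, hence zero by simplicity. The eigenvector need not be
    homogeneous. *)
Lemma schur (k : closedFieldType) (C : gcoalgebra k) b (V M : comodule C)
    (T : set V) (p q : V -> M) v :
  simple_subcomod T -> phom b T p -> phom b T q -> T v -> p v <> 0 ->
  q @` T `<=` p @` T -> exists a : k, forall t, T t -> q t = a *: p t.
Proof.
move=> sT pT qT Tv pv qp.
have [n Tn] := simple_finite sT.
have sT' := subcomod_subspace (simpleW sT).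
have [phi [iphi rphi]] := (has_dimP n sT').1 Tn.
have Tphi c : T (phi c) by rewrite -rphi; exists c.
have phiT t : T t -> exists c, phi c = t.
  by rewrite -rphi => -[c _ <-]; exists c.
have pinj := phom_inj (simpleW sT) pT (simple_phom_inj sT pT Tv pv).
have ex c : exists d, p (phi d) = q (phi c).
  have [|t Tt <-] := qp (q (phi c)); first by exists (phi c).
  by have [d <-] := phiT _ Tt; exists d.
have [f fE] := choice ex.
have fl : linear f.
  move=> a c d; apply: iphi; apply: pinj => //; rewrite !fE !linearP.
  case: pT qT => p1 _ _ [q1 _ _]; rewrite [RHS]p1// !fE q1//.
pose A := lin1_mx (linmap fl).
(* A characteristic polynomial of degree 0 would have no root. *)
have n0 : (0 < n)%N.
  rewrite lt0n; apply/eqP => n0; apply: pv; have [c cv] := phiT _ Tv.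
  suff -> : v = 0 by rewrite (phom0 (simpleW sT) pT).
  rewrite -cv (_ : c = 0) ?linear0//; apply/rowP => i.
  by have := leq_ltn_trans (leq0n i) (ltn_ord i); rewrite [X in (0 < X)%N]n0.
have [a /eigenvalueP[c cA c0]] : exists a, eigenvalue A a.
  have : size (char_poly A) != 1%N by rewrite size_char_poly eqSS -lt0n.
  move=> /closed_rootP[a ra]; exists a.
  by rewrite eigenvalue_root_char.
exists a => t Tt.
pose h x := q x - a *: p x.
have hT : phom b T h.
  case: (pT) (qT) => p1 p2 p3 [q1 q2 q3]; split=> [d u w Tu Tw|g u Tu|g u Tu gu].
  - by rewrite /h p1// q1// scalerDr opprD addrACA scalerBr !scalerA mulrC.
  - by rewrite /h p2// q2// linearB (linearZ_LR (act M g)).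
  - apply: is_subspaceB; try exact: gpart_subspace; first exact: q3.
    by apply: is_subspaceZ; [exact: gpart_subspace|exact: p3].
have hc : h (phi c) = 0.
  rewrite /h -fE -(phomZ (simpleW sT) pT)// -linearZ -cA.
  by rewrite (_ : f c = c *m A) ?subrr// mul_rV_lin1.
apply/eqP; rewrite -subr_eq0; apply/eqP; apply: contrapT => ht.
have := simple_phom_inj sT hT Tt ht (Tphi c) hc.
by rewrite -(linear0 phi) => /iphi /eqP; rewrite (negbTE c0).
Qed.

(** * The extension property for C, shifts and retracts *)

Section Extension.
Variables (k : fieldType) (C : gcoalgebra k).
Implicit Types (V M W : comodule C).

(* Injectivity with respect to maps defined on finite-dimensional subcomodules
   only: unlike plain splitting, it visibly passes to infinite direct sums. *)
Definition extensible M : Prop :=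
  forall V (X : set V) b (h : V -> M), is_subcomod X -> finite_dim X ->
    phom b X h ->
    exists H : {linear V -> M}, phom b [set: V] H /\ forall x, X x -> H x = h x.

(** The functional [counit \o h] extends from X to V by a linear projection onto X. Restricting it
    to the degree b component first makes the associated map to C homogeneous of degree b. *)
Lemma regular_extensible : extensible (regular_comodule C).
Proof.
move=> V X b h sX _ hX; have sX' := subcomod_subspace sX.
have [p [Xp pX]] := subspace_proj sX'.
have ll : linear ((fun v => counit C (h (p (gproj V b v)))) : V -> k^o).
  by move=> a u v; rewrite !linearP; case: hX => -> // _ _; rewrite linearP.
have lb v : gpart (~~ b) v -> linmap ll v = 0.
  by move=> /gproj_out; rewrite negbK /= => ->; rewrite linear0 (phom0 sX hX) linear0.
exists (cofun (linmap ll)); split; first exact: phom_cofun.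
move=> x Xx; apply: functional_separates => f; rewrite functional_cofun.
have XA g : X (gproj V g (act V f x)).
  by case/is_subcomodP: sX => _ aX gX; apply: gX; apply: aX.
case: (hX) => _ h2 _.
apply: (eq_trans _ (etrans (congr1 (counit C) (h2 f x Xx)) (counit_act f (h x)))).
rewrite -[LHS]/(counit C (h (p (gproj V b (act V f x))))) pX; last exact: XA.
(* h sends the component of degree [~~ b] to an odd element, which the counit kills. *)
have -> : h (act V f x) = h (gproj V b (act V f x)) + h (gproj V (~~ b) (act V f x)).
  by rewrite -(phomD hX (XA _) (XA _)) -gprojDb.
rewrite linearD [X in _ = _ + X]counit_deg0 ?addr0//.
have : gpart (b (+) ~~ b) (h (gproj V (~~ b) (act V f x))).
  by case: hX => _ _; apply=> //; apply: gprojP.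
by rewrite addbN addbb.
Qed.

Lemma shift_extensible M : extensible M -> extensible (shift M).
Proof.
move=> eM V X b h sX fX hX; have [|H [hH HX]] := eM V X (~~ b) h sX fX.
  by apply/phom_shift; rewrite negbK.
by exists H; split=> //; have := (phom_shift _ _ _).1 hH; rewrite negbK.
Qed.

(** r is the projection of W onto M along X: a map into M is extended as a map into W and then
    composed with r. *)
Lemma retract_extensible M W (i : {linear M -> W}) (X : set W) :
  comod_hom i -> injective i -> is_subcomod X ->
  direct_complements (range i) X -> extensible W -> extensible M.
Proof.
move=> /comod_homP hi ii sX [iX0 iXT] eW.
have sX' := subcomod_subspace sX.
have ex w : exists m, X (w - i m).
  have [_ [x [[m _ <-] Xx ->]]] := iXT w; exists m.
  by rewrite addrC addKr.
have [r rP] := choice ex.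
have rE w m : X (w - i m) -> r w = m.
  move=> Xm; apply: ii; apply/eqP; rewrite -subr_eq0; apply/eqP.
  suff : [set 0] (i (r w) - i m) by [].
  rewrite -iX0; split; first by exists (r w - m) => //; rewrite linearB.
  have := is_subspaceB sX' Xm (rP w).
  by rewrite opprB addrC addrA subrK.
have rl : linear r.
  move=> a u v; apply: rE; rewrite linearP opprD addrACA -scalerBr.
  exact: sX'.2.
have hr : phom false [set: W] r.
  case/is_subcomodP: (sX) => _ aX gX; case: (hi) => _ i2 _.
  split=> [a u v _ _|f v _|g v _ gv]; first exact: rl.
    by apply: rE; rewrite i2// -linearB; apply: aX.
  suff -> : r v = gproj M g (r v) by apply: gprojP.
  apply: rE; rewrite -[g](addFb g) (phom_gproj (subcomodT M) hi)//.
  by rewrite -[in X in X - _](gproj_id gv) -linearB; apply: gX.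
move=> V Y b h sY fY hY.
have hiY := phom_comp (fun _ _ => I) hY hi; rewrite addbF in hiY.
have [H [hH HY]] := eW V Y b (i \o h) sY fY hiY.
exists (linmap rl \o H); split=> [|y Yy].
  by rewrite -[b]addbF; apply: (phom_comp _ hH hr).
by rewrite /= HY//; apply: rE; rewrite subrr; apply: sX'.1.
Qed.

End Extension.

(** * Maps into and out of direct sums *)

Section DirectSums.
Variables (k : fieldType) (C : gcoalgebra k) (T : choiceType) (M : T -> comodule C).
Implicit Types (V W : comodule C).

Local Notation D := (comod_dsum M).

Definition dsum_inj t : {linear M t -> D} := @dsum_in k T (fun t => M t) t.

Lemma dsum_eval_linear t : linear ((fun x : D => x t) : D -> M t).
Proof. by move=> a x y; rewrite -dsumZE -dsumDE. Qed.

Definition dsum_eval t : {linear D -> M t} := linmap (@dsum_eval_linear t).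

Lemma phom_dsum_inj t : phom false [set: M t] (dsum_inj t).
Proof.
apply/comod_homP; split=> [g v gv|v]; last exact: (dsum_coactE (M := M)).
by move=> /= s; case: dfwithP => // j _; exact: (gpart_subspace _ _).1.
Qed.

Lemma phom_dsum_eval t : phom false [set: D] (dsum_eval t).
Proof.
split=> [a u v _ _|f x _|g x _]; [by rewrite linearP| |exact].
pose h1 : {linear D -> M t} := dsum_eval t \o act D f.
pose h2 : {linear D -> M t} := act (M t) f \o dsum_eval t.
rewrite -[LHS]/(h1 x) -[RHS]/(h2 x).
apply: (@dsum_ext k T (fun t => M t) (M t) h1 h2) => s m.
rewrite -[LHS]/(dsum_eval t (act D f (dsum_inj s m))).
rewrite -[RHS]/(act (M t) f (dsum_eval t (dsum_inj s m))).
case: (phom_dsum_inj s) => _ h _; rewrite -h//.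
rewrite -[LHS]/(dfwith (fun t => 0 : M t) (act (M s) f m) t).
rewrite -[RHS]/(act (M t) f (dfwith (fun t => 0 : M t) m t)).
have [st|st] := eqVneq s t.
  by move: (m); rewrite st => m'; rewrite !dfwith_in.
by rewrite !dfwith_out// linear0.
Qed.

Lemma phom_dsum_lift W (h : forall t, {linear M t -> W}) :
  (forall t, phom false [set: M t] (h t)) -> phom false [set: D] (dsum_lift h).
Proof.
move=> hh; split=> [a u v _ _|f x _|g x _ gx]; first exact: dsum_lift_linear.
  pose h1 : {linear D -> W} := (dsum_lift h : {linear D -> W}) \o act D f.
  pose h2 : {linear D -> W} := act W f \o (dsum_lift h : {linear D -> W}).
  rewrite -[LHS]/(h1 x) -[RHS]/(h2 x).
  apply: (@dsum_ext k T (fun t => M t) W h1 h2) => s m.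
  rewrite -[LHS]/(dsum_lift h (act D f (dsum_inj s m))).
  rewrite -[RHS]/(act W f (dsum_lift h (dsum_inj s m))).
  case: (phom_dsum_inj s) => _ h0 _; rewrite -h0// /dsum_inj /= !dsum_liftE.
  by case: (hh s) => _ h3 _; apply: h3.
apply: is_subspace_sum => [|t _]; first exact: gpart_subspace.
by case: (hh t) => _ _; apply=> //; apply: gx.
Qed.

Lemma dsum_extensible : (forall t, extensible (M t)) -> extensible D.
Proof.
move=> eM V X b h sX fX hX; have [n [e [Xe eX]]] := fX.
pose ht t v : M t := h v t.
have hhX t : phom b X (ht t).
  by rewrite -[b]addbF; apply: phom_comp hX (phom_dsum_eval t).
(* A component that is zero on X is extended by zero. Since X is finite-dimensional, only finitely
   many components are nonzero on X, so the extensions assemble to finitely supported families. *)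
have ex t : {H : {linear V -> M t} | [/\ phom b [set: V] H, forall x, X x -> H x = ht t x &
    (forall x, X x -> ht t x = 0) -> forall x, H x = 0]}.
  apply: cid; have [h0|h0] := EM (forall x, X x -> ht t x = 0).
    exists \0; split=> // [|x /h0->//]; split=> [a u v _ _|f v _|g v _ _].
    - by rewrite /= scaler0 addr0.
    - by rewrite -[RHS]/(act (M t) f 0) linear0.
    - exact: (gpart_subspace _ _).1.
  by have [H [? ?]] := eM t V X b (ht t) sX fX (hhX t); exists H; split.
pose H t := sval (ex t).
have fin v : finite_set [set t | H t v != 0].
  apply: (@sub_finite_set _ _ (\bigcup_(i in [set: 'I_n]) [set t | h (e i) t != 0])); last first.
    by apply: bigcup_finite => // i _; apply: dsum_finite.
  move=> t /= Htv; apply: contrapT => no.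
  move: Htv; rewrite /H; case: (ex t) => /= Ht [_ _ ->]; rewrite ?eqxx// => x Xx.
  have [c [xE _]] := eX _ Xx.
  rewrite [x in LHS]xE -[X in ht t X]/(lincomb e c) (phom_lincomb sX (hhX t))// /lincomb big1// => i _.
  rewrite /= (_ : ht t (e i) = 0) ?scaler0//; apply: contrapT => hi.
  by apply: no; exists i => //=; apply/eqP.
have Hl : linear ((fun v => Dsum (fin v)) : V -> D).
  by move=> a u v; apply: dsumP => t; rewrite dsumDE dsumZE /= linearP.
exists (linmap Hl); split=> [|x Xx]; last first.
  by apply: dsumP => t /=; rewrite /H; case: (ex t) => /= Ht [_ E _]; apply: E.
split=> [a u v _ _|f v _|g v _ gv]; first by rewrite linearP.
  apply: dsumP => t; case: (phom_dsum_eval t) => _ h2 _.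
  rewrite [RHS](h2 f (linmap Hl v) Logic.I) /= /H.
  by case: (ex t) => /= Ht [[_ h3 _] _ _]; apply: h3.
by move=> t /=; rewrite /H; case: (ex t) => /= Ht [[_ _ h3] _ _]; apply: h3.
Qed.

Lemma range_dsum_lift W (h : forall t, {linear M t -> W}) t :
  range (h t) `<=` range (dsum_lift h).
Proof. by move=> _ [m _ <-]; exists (dsum_inj t m) => //; apply: dsum_liftE. Qed.

Lemma dsum_neq0 (x : D) : x <> 0 -> exists t, x t <> 0.
Proof.
move=> x0; apply: contrapT => no; apply: x0; apply: dsumP => t.
by apply: contrapT => xt; apply: no; exists t.
Qed.

(* For X simple: X, up to a shift of degree b, embeds into W. *)
Definition meets b V (X : set V) W : Prop :=
  exists p : V -> W, phom b X p /\ exists2 v, X v & p v <> 0.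

Lemma meets_dsum b V (X : set V) : meets b X D -> exists t, meets b X (M t).
Proof.
move=> [p [pX [v Xv pv]]]; have [t pvt] := dsum_neq0 pv; exists t.
exists (dsum_eval t \o p); split; last by exists v.
by rewrite -[b]addbF; apply: phom_comp pX (phom_dsum_eval t).
Qed.

(** A nonzero kernel contains a simple X. As X embeds in only one summand, it lies inside that
    summand, where the map is injective. *)
Lemma dsum_lift_injective W (h : forall t, {linear M t -> W}) :
  (forall t, phom false [set: M t] (h t)) -> (forall t, injective (h t)) ->
  (forall V (X : set V) s t, simple_subcomod X ->
     meets false X (M s) -> meets false X (M t) -> s = t) ->
  injective (dsum_lift h : D -> W).
Proof.
move=> hh hi hM.
have hD := phom_dsum_lift hh.
suff K0 (x : D) : dsum_lift h x = 0 -> x = 0.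
  by move=> x y xy; apply: (phom_inj (subcomodT D) hD) => //; move=> v _ /K0.
move=> x0; apply: contrapT => nx.
have sK := phom_ker (subcomodT D) hD.
have [X sX XK] := exists_simple sK (conj Logic.I x0) nx.
have [v Xv v0] := simple_neq0 sX.
have ev s : phom false X (dsum_eval s) := phom_sub (fun _ _ => Logic.I) (phom_dsum_eval s).
have [t vt] := dsum_neq0 v0.
have vE : v = dsum_inj t (v t).
  apply: dsumP => s /=; have [<-|ts] := eqVneq t s; first by rewrite dfwith_in.
  rewrite dfwith_out//; apply: contrapT => vs; move/eqP: ts; apply.
  by apply: (hM _ X) => //; [exists (dsum_eval t)|exists (dsum_eval s)]; split=> //; exists v.
have [_] := XK v Xv; rewrite vE /dsum_inj /= dsum_liftE => hv.
by apply: vt; apply: (hi t); rewrite hv linear0.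
Qed.

End DirectSums.

(** For equal summands a simple X in the kernel may lie diagonally. By Schur's lemma its components
    are multiples of a single one, and independence of the l i on S rules this out. *)
Lemma copies_lift_injective (k : closedFieldType) (C : gcoalgebra k) (M : comodule C)
    (S : set M) m (l : 'I_m -> {linear M -> k^o}) :
  (forall (V : comodule C) (X : set V) (h : V -> M) v, simple_subcomod X -> phom false X h ->
     X v -> h v <> 0 -> h @` X = S) ->
  (forall i v, gpart true v -> l i v = 0) ->
  (forall c : 'rV[k]_m, (forall s, S s -> \sum_i c 0 i * l i s = 0) -> c = 0) ->
  injective (dsum_lift (fun i => cofun (l i)) : comod_copies m M -> C).
Proof.
move=> MS l0 li; set F := dsum_lift _.
have hD : phom (M := regular_comodule C) false [set: comod_copies m M] F.
  exact (@phom_dsum_lift k C _ (fun _ : 'I_m => M) (regular_comodule C) (fun i => cofun (l i)) (fun i => @phom_cofun k C false M (l i) (l0 i))).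
suff K0 (x : comod_copies m M) : F x = 0 -> x = 0.
  by move=> x y xy; apply: (phom_inj (subcomodT _) hD) => //; move=> v _ /K0.
move=> x0; apply: contrapT => nx.
have sK := phom_ker (subcomodT _) hD.
have [X sX XK] := exists_simple sK (conj Logic.I x0) nx.
have [v Xv v0] := simple_neq0 sX.
pose p i : comod_copies m M -> M := dsum_eval (fun _ : 'I_m => M) i.
have ev i : phom false X (p i).
  exact: phom_sub (fun _ _ => Logic.I) (phom_dsum_eval (fun _ : 'I_m => M) i).
have [t vt] := dsum_neq0 v0.
have ptS : p t @` X = S by apply: (MS _ _ _ v).
have ex i : exists a, forall x, X x -> p i x = a *: p t x.
  apply: (schur sX (ev t) (ev i) Xv vt).
  (* A nonzero component has the same image S as [p t]; a component vanishing on X has image 0, also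
     inside the image of [p t]. *)
  have [[w Xw pw]|no] := EM (exists2 w, X w & p i w <> 0).
    by rewrite ptS -(MS _ _ _ w sX (ev i) Xw pw).
  move=> _ [w Xw <-]; exists 0; last rewrite (phom0 (simpleW sX) (ev t)).
    exact: (subcomod_subspace (simpleW sX)).1.
  by apply/esym; apply: contrapT => pw; apply: no; exists w.
have [a aE] := choice ex.
have at0 : a t = 0.
  have := li (\row_i a i); rewrite -ptS => /(_ _)/rowP/(_ t); rewrite !mxE; apply.
  move=> _ [y Xy <-]; have [_ Fx] := XK y Xy.
  (* Applied to F y = 0, the counit gives the relation with coefficients a i between the values of
     the l i at [p t y], and these points fill S. *)
  have := congr1 (counit C) Fx; rewrite linear0 /F.
  rewrite (@dsum_lift_seq _ _ _ _ _ (enum 'I_m)) ?enum_uniq//; last first.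
    by move=> i _; rewrite mem_enum.
  rewrite linear_sum big_enum /= => E; rewrite -[RHS]E; apply: eq_bigr => i _.
  rewrite counit_cofun mxE.
  by have -> : (y : comod_copies m M) i = a i *: p t y := aE i y Xy; rewrite (linearZ_LR (l i)).
by apply: vt; rewrite -[v t]/(p t v) aE// at0 scale0r.
Qed.

(** * Comodules with simple socle *)

Section SubcomoduleModel.
Variables (k : fieldType) (C : gcoalgebra k) (V : comodule C) (U : lmodType k).
Variable inc : {linear U -> V}.
Hypotheses (inc_inj : injective inc) (inc_sub : is_subcomod (range inc)).

Let X := range inc.
Let sX : is_subspace X. Proof. by case/is_subcomodP: inc_sub. Qed.
Let aX f x : X x -> X (act V f x). Proof. by case/is_subcomodP: inc_sub => _ + _; apply. Qed.
Let gX b x : X x -> X (gproj V b x). Proof. by case/is_subcomodP: inc_sub => _ _; apply. Qed.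

(** Any linear projection onto X becomes homogeneous when only its even-to-even and odd-to-odd
    blocks are kept; this is q. *)
Let graded_retraction : exists r : {linear V -> U},
  cancel inc r /\ forall g v, gpart g v -> gpart g (inc (r v)).
Proof.
have [p [Xp pX]] := subspace_proj sX.
pose q v := gproj V false (p (gproj V false v)) + gproj V true (p (gproj V true v)).
have Xq v : X (q v) by apply: is_subspaceD => //; apply: gX.
have ex v : exists u, inc u = q v by have [u _ <-] := Xq v; exists u.
have [r rE] := choice ex.
have rl : linear r.
  move=> a u v; apply: inc_inj; rewrite linearP !rE /q !linearP.
  by rewrite scalerDr addrACA.
exists (linmap rl); split=> [u|g v gv].
  apply: inc_inj; rewrite /= rE /q !pX ?gproj_idem -?gprojD//; apply: gX; by exists u.
rewrite /= rE /q.
by case: g gv => gv; rewrite (gproj_out gv) !linear0 ?add0r ?addr0; apply: gprojP.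
Qed.

Let r : {linear V -> U} := sval (cid graded_retraction).
Let rK : cancel inc r. Proof. by rewrite /r; case: cid => ? []. Qed.
Let r_part g v : gpart g v -> gpart g (inc (r v)).
Proof. by rewrite /r; case: cid => ? [? h]; apply: h. Qed.

Let U_gspace : gspace k.
Proof.
refine (@GSpace k U (fun g => [set u | gpart g (inc u)]) _ _ _).
- move=> g; have [h0 h2] := gpart_subspace V g; split; rewrite /mkset ?linear0//.
  by move=> a u v gu gv; rewrite linearP; apply: h2.
- move=> v; exists (r (gproj V false (inc v))), (r (gproj V true (inc v))); split.
  + exact: r_part (gprojP _ _).
  + exact: r_part (gprojP _ _).
  + by rewrite -linearD -gprojD rK.
- by move=> v v0 v1; apply: inc_inj; rewrite linear0; apply: gpart_direct.
Defined.

(** Retracting the left factor loses nothing, because the coaction sends X into X ⊗ C; the comodule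
    axioms can then be checked after applying [inc]. *)
Let U_coact : {linear U -> tens U C} := tmap r idfun \o (coact V \o inc).

Let inc_coact u : tmap inc idfun (U_coact u) = coact V (inc u).
Proof.
have iX : X (inc u) by exists u.
have := inc_sub.1.2 _ iX; rewrite /U_coact /=; move: (coact V (inc u)).
pose h : {linear tens V C -> tens V C} := tmap inc idfun \o tmap r idfun.
have sQ : is_subspace [set y | h y = y].
  by split=> [|a y z yE zE]; rewrite /mkset ?linear0// linearP yE zE.
apply: (span_sub sQ) => _ [_ [c [[w _ <-] ->]]].
by rewrite /h /= !tmapE /= rK.
Qed.

Let tmap_incK (W : lmodType k) : cancel (tmap inc (@idfun W)) (tmap r (@idfun W)).
Proof.
move=> t; pose h : {linear tens U W -> tens U W} := tmap r idfun \o tmap inc idfun.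
rewrite -[LHS]/(h t) -[RHS]/(idfun t); apply: tens_ext => u w.
by rewrite /h /= !tmapE /= rK.
Qed.

Let U_coact_deg0 g (u : U_gspace) :
  gpart g u -> @tens_part k U_gspace C g (U_coact u).
Proof.
move=> gu; have := coact_deg0 (gu : gpart g (inc u)).
rewrite /U_coact /=; move: (coact V (inc u)).
have sS : is_subspace (@tens_part k U_gspace C g) by apply: span_subspace.
pose Q := [set y : tens V C | @tens_part k U_gspace C g (tmap r idfun y)].
have sQ : is_subspace Q.
  by split=> [|a y z]; rewrite /Q /= ?linear0 ?linearP; [apply: sS.1 | apply: sS.2].
apply: (span_sub sQ) => _ [a [b [v [c [abg gv gc ->]]]]].
rewrite /Q /= tmapE; apply: Defs.sub_span; exists a, b, (r v), c; split=> //.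
exact: r_part.
Qed.

Let tassoc_inc (W : lmodType k) (t : tens U C) (w : W) :
  tmap inc idfun (tassoc (t ⊗ w)) = tassoc (tmap inc idfun t ⊗ w).
Proof.
have lc (A B : lmodType k) : linear (fun y : tens A B => y ⊗ w).
  by move=> a y z; rewrite tpureDl.
pose h1 : {linear tens U C -> tens V (tens C W)} :=
  tmap inc idfun \o (@tassoc k U C W \o linmap (lc U C)).
pose h2 : {linear tens U C -> tens V (tens C W)} :=
  (@tassoc k V C W \o linmap (lc V C)) \o tmap inc idfun.
rewrite -[LHS]/(h1 t) -[RHS]/(h2 t); apply: tens_ext => u c.
by rewrite /h1 /h2 /= !(tmapE, tassocE).
Qed.

Let U_coactA (u : U_gspace) :
  tassoc (tmap U_coact idfun (U_coact u)) = tmap idfun (comul C) (U_coact u).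
Proof.
apply: (can_inj (tmap_incK (W := tens C C))).
pose h1 : {linear tens U C -> tens V (tens C C)} :=
  tmap inc idfun \o (@tassoc k U C C \o tmap U_coact idfun).
pose h2 : {linear tens U C -> tens V (tens C C)} :=
  (@tassoc k V C C \o tmap (coact V) idfun) \o tmap inc idfun.
have h12 : h1 =1 h2.
  apply: tens_ext => v c; rewrite /h1 /h2 -[LHS]/(tmap inc idfun (tassoc (tmap U_coact idfun (v ⊗ c)))).
  by rewrite tmapE tassoc_inc inc_coact /= !tmapE.
rewrite -[LHS]/(h1 _) h12 /h2 -[LHS]/(tassoc (tmap (coact V) idfun (tmap inc idfun (U_coact u)))).
rewrite inc_coact coactA -inc_coact.
pose h3 : {linear tens U C -> tens V (tens C C)} := tmap idfun (comul C) \o tmap inc idfun.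
pose h4 : {linear tens U C -> tens V (tens C C)} := tmap inc idfun \o tmap idfun (comul C).
rewrite -[LHS]/(h3 _) -[RHS]/(h4 _); apply: tens_ext => v c.
by rewrite /h3 /h4 /= !tmapE.
Qed.

Let U_coact_counit (u : U_gspace) : tunitr (tmap idfun (counit C) (U_coact u)) = u.
Proof.
apply: inc_inj; rewrite -[RHS]coact_counit -inc_coact.
pose h1 : {linear tens U C -> V} := inc \o (@tunitr k U \o tmap idfun (counit C)).
pose h2 : {linear tens U C -> V} := (@tunitr k V \o tmap idfun (counit C)) \o tmap inc idfun.
rewrite -[LHS]/(h1 _) -[RHS]/(h2 _); apply: tens_ext => v c.
by rewrite /h1 /h2 /= !tmapE !tunitrE linearZ.
Qed.

Lemma subcomod_model : exists (S : comodule C) (i : {linear S -> V}),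
  [/\ comod_hom i, injective i & range i = range inc].
Proof.
exists (@Comodule k C U_gspace U_coact U_coact_deg0 U_coactA U_coact_counit), inc.
by split=> //; split=> // v; rewrite inc_coact.
Qed.

End SubcomoduleModel.

(** The hypotheses on the family I quantify over comodules, whereas simple constituents arise as
    subsets. Finite dimension supplies the underlying space, a space of row vectors. *)
Lemma simple_model (k : fieldType) (C : gcoalgebra k) (V : comodule C) (T : set V) :
  simple_subcomod T -> exists (S : comodule C) (i : {linear S -> V}),
  [/\ simple_comod S, phom false [set: S] i, injective i & range i = T].
Proof.
move=> sT; have [n Tn] := simple_finite sT.
have [phi [iphi rphi]] := (has_dimP n (subcomod_subspace (simpleW sT))).1 Tn.
have [|S [i [/comod_homP hi ii ri]]] := @subcomod_model k C V _ phi iphi.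
  by rewrite rphi; apply: simpleW.
exists S, i; split=> //; last by rewrite ri.
rewrite rphi in ri.
have Ti s : T (i s) by rewrite -ri; exists s.
split; first exact: subcomodT.
  move=> S0; have [v Tv v0] := simple_neq0 sT; apply: v0.
  move: Tv; rewrite -ri => -[s _ <-]; suff -> : s = 0 by rewrite linear0.
  by have : [set: S] s by []; rewrite S0.
move=> X sX _; have hX := phom_sub (fun _ _ => Logic.I) hi : phom false X i.
have [_ _ /(_ _ (phom_image sX hX)) []] := sT.
- by move=> _ [x _ <-].
- move=> X0; left; apply/seteqP; split=> [x Xx|_ ->].
    by apply: ii; rewrite linear0; have : (i @` X) (i x) by [exists x]; rewrite X0.
  exact: (subcomod_subspace sX).1.
- move=> XT; right; apply/seteqP; split=> // s _.
  by have := Ti s; rewrite -XT => -[x Xx /ii <-].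
Qed.

Section SimpleSocle.
Variables (k : fieldType) (C : gcoalgebra k).
Implicit Types (S V M : comodule C).

Definition shiftb (b : bool) V : comodule C := if b then shift V else V.

Lemma phom_from_shift b V M (X : set V) (h : V -> M) :
  phom b X h <-> phom (V := shift V) (~~ b) X h.
Proof.
by split=> -[h1 h2 h3]; split=> // g v Xv gv; have := h3 (~~ g) v Xv; rewrite /= ?negbK
  addbN ?addNb ?negbK; apply; rewrite /= ?negbK.
Qed.

Lemma meets_shift b V M (X : set V) : meets b X (shift M) <-> meets (~~ b) X M.
Proof.
split=> -[p [hp pX]]; exists p; split=> //.
  by apply/phom_shift; rewrite negbK.
by have := (phom_shift _ _ _).1 hp; rewrite negbK.
Qed.

Lemma simple_socle_of_cover S M :
  simple_comod S -> injective_cover S M -> simple_subcomod (socle M).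
Proof.
move=> sS [_ _ [f [/comod_homP hf fi <-]]].
have [v _ v0] := simple_neq0 sS.
by apply: (simple_image sS hf (v := v)) => //; rewrite -(linear0 f) => /fi.
Qed.

(** Splitting, applied to the embedding into C, exhibits M as a retract of C. *)
Lemma extensible_of_cover S M :
  injective_cover S M -> embeds M (regular_comodule C) -> extensible M.
Proof.
move=> [_ Minj _] [i [hi ii]]; have [X sX iX] := Minj _ _ hi ii.
exact (@retract_extensible k C M (regular_comodule C) i X hi ii sX iX (@regular_extensible k C)).
Qed.

(** A nonzero map from S fills the simple socle of M, so M also covers S, shifted by the degree of
    the map. With [meets_of_cover] this translates covers into [meets]. *)
Lemma cover_of_meets b S0 S M :
  simple_comod S0 -> injective_cover S0 M -> simple_comod S ->
  meets b [set: S] M -> injective_cover (shiftb b S) M.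
Proof.
move=> sS0 cM sS [p [hp [v _ pv]]]; have sM := simple_socle_of_cover sS0 cM.
case: cM => indM injM _; split=> //.
have pl : linear p by move=> a x y; case: hp => h1 _ _; apply: h1.
have pI := phom_inj (simpleW sS) hp (simple_phom_inj sS hp Logic.I pv).
have pE := simple_image_socle sM sS hp Logic.I pv.
case: b hp {pv} pI pE => hp pI pE /=.
  exists (linmap (pl : linear (p : shift S -> M))); split=> //.
    by apply/comod_homP; exact: ((phom_from_shift _ _ _).1 hp).
  by move=> x y; apply: pI.
exists (linmap pl); split=> //; first exact/comod_homP.
by move=> x y; apply: pI.
Qed.

Lemma meets_of_cover b S M V (T : set V) (i : {linear S -> V}) :
  simple_comod S -> phom false [set: S] i -> injective i -> range i = T ->
  injective_cover (shiftb b S) M -> meets b T M.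
Proof.
move=> sS hi ii iT [_ _ [f [/comod_homP hf fi _]]].
have [v _ v0] := simple_neq0 sS.
have i0 s : [set: S] s -> i s = 0 -> s = 0 by rewrite -(linear0 i) => _ /ii.
have [i' [hi' i'K iK']] := phom_inverse (simpleW sS) hi i0.
move: f hf fi; rewrite /shiftb => f hf fi.
have hf' : exists g : S -> M, phom b [set: S] g /\ g v <> 0.
  move: f hf fi; case: b => f hf fi.
    exists f; split; first exact/phom_from_shift.
    by move=> fv; apply: v0; apply: fi; rewrite fv linear0.
  exists f; split=> //.
  by move=> fv; apply: v0; apply: fi; rewrite fv linear0.
have [g [hg gv]] := hf'.
exists (g \o i'); split; first by rewrite -iT; apply: phom_comp hi' hg.
exists (i v); first by rewrite -iT; exists v.
by rewrite /= i'K.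
Qed.

(** Transport along p: its inverse Y -> X has degree b, and following it by a map of degree c adds
    the degrees. *)
Lemma meets_comp b c V V' M (X : set V) (Y : set V') (p : V -> V') v :
  simple_subcomod X -> simple_subcomod Y -> phom b X p -> X v -> p v <> 0 -> p @` X = Y ->
  meets c X M -> meets (b (+) c) Y M.
Proof.
move=> sX sY hp Xv pv pX [q [hq [w Xw qw]]].
have [p' [hp' p'K pK']] := phom_inverse (simpleW sX) hp (simple_phom_inj sX hp Xv pv).
rewrite pX in hp' pK'.
exists (q \o p'); split; first by apply: phom_comp hp' hq => y /pK'[].
by exists (p w); rewrite -?pX//=; [exists w|rewrite p'K].
Qed.

Lemma socle_part_subspace M b : is_subspace (socle_part M b).
Proof.
apply: is_subspaceI; last exact: gpart_subspace.
exact: subcomod_subspace (socle_subcomod M).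
Qed.

Lemma socle_part_finite M b : simple_subcomod (socle M) -> finite_dim (socle_part M b).
Proof.
move=> sM; have sM' := subcomod_subspace (simpleW sM).
apply: (finite_dim_subspace sM' _ (simple_finite sM)); last by move=> ? [].
exact: socle_part_subspace.
Qed.

(* An ungraded subcomodule X, neither 0 nor the simple socle, contains no
   homogeneous elements, and its projections to the even and the odd part are
   onto; hence X is the graph of an odd automorphism. *)
Lemma odd_automorphism M :
  simple_subcomod (socle M) -> ~ absolutely_simple_socle M ->
  meets true (socle M) M.
Proof.
move=> sM nabs; set Z := socle M in sM nabs *.
have [X [/ungraded_subcomodP[sX aX] XZ X0 XnZ]] : exists X : set M,
    [/\ is_ungraded_subcomod X, X `<=` Z, X <> [set 0] & X <> Z].
  apply: contrapT => no; apply: nabs; split=> // X uX XZ.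
  have [|X0] := EM (X = [set 0]); [by left|right].
  by apply: contrapT => XnZ; apply: no; exists X.
case/is_subcomodP: (simpleW sM) => sZ aZ gZ.
have homog b x : X x -> gpart b x -> x = 0.
  move=> Xx bx; apply: contrapT => x0.
  (* The largest graded subcomodule inside X; a nonzero homogeneous x in X would make it all of
     Z. *)
  pose Y : set M := [set v | X (gproj M false v) /\ X (gproj M true v)].
  have YX : Y `<=` X by move=> v [? ?]; rewrite (gprojD v); apply: is_subspaceD.
  apply: XnZ; apply/seteqP; split=> //.
  have <- : Y = Z; last by [].
  apply: (simple_sub sM _ _ _ x0); last 1 first.
  - case: b bx => bx; split; rewrite ?(gproj_id bx)// (gproj_out bx); exact: sX.1.
  - apply/is_subcomodP; split.
    + split=> [|a u v [u0 u1] [v0 v1]]; first by split; rewrite linear0; apply: sX.1.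
      by split; rewrite linearP; apply: sX.2.
    + move=> f v [v0 v1]; split; rewrite gproj_act; apply: is_subspaceD => //; exact: aX.
    + move=> [] v [v0 v1]; split; rewrite ?gproj_idem ?gproj_tf ?gproj_ft//; exact: sX.1.
  - by move=> v /YX/XZ.
(* With X seen as a graph from even to odd parts, x applies it to the even component of v, and y
   applies its inverse to the odd one. *)
pose R (v w : M) := exists x y, [/\ X x, X y,
  v = gproj M false x + gproj M true y & w = gproj M true x + gproj M false y].
have Rlin a u u' v v' : R u u' -> R v v' -> R (a *: u + v) (a *: u' + v').
  move=> [x [y [Xx Xy -> ->]]] [x' [y' [Xx' Xy' -> ->]]].
  exists (a *: x + x'), (a *: y + y'); split; try exact: sX.2.
    by rewrite !linearP scalerDr addrACA.
  by rewrite !linearP scalerDr addrACA.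
have Rsym u v : R u v -> R v u.
  by move=> [x [y [Xx Xy -> ->]]]; exists y, x; split; rewrite // addrC.
have Ract f v w : R v w -> R (act M f v) (act M f w).
  move=> [x [y [Xx Xy -> ->]]].
  (* The even part of f preserves the roles of x and y, the odd part exchanges them. *)
  exists (act M (fproj f false) x + act M (fproj f true) y),
         (act M (fproj f true) x + act M (fproj f false) y).
  have F b g := gproj_act_fproj (V := M) f b g.
  split; try by apply: is_subspaceD => //; apply: aX.
    rewrite !linearD (F false false) (F true true) (F true false) (F false true).
    by rewrite !(act_fproj f) [X in _ + X = _]addrC addrACA.
  rewrite !linearD (F false true) (F true false) (F true true) (F false false).
  by rewrite !(act_fproj f) [X in _ + X = _]addrC addrACA.
have Rproj b v w : R v w -> R (gproj M b v) (gproj M (~~ b) w).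
  move=> [x [y [Xx Xy -> ->]]].
  have X00 := sX.1.
  case: b; [exists 0, y|exists x, 0]; split=> //;
    rewrite !linearD !(gproj_idem, gproj_tf, gproj_ft) ?linear0 ?add0r ?addr0//.
have R0 w : R 0 w -> w = 0.
  move=> [x [y [Xx Xy E ->]]].
  (* If v = 0, then x is odd and y is even, so both vanish by [homog]. *)
  have x0 : gproj M false x = 0.
    by have := congr1 (gproj M false) E; rewrite linear0 linearD gproj_idem gproj_ft addr0.
  have y0 : gproj M true y = 0.
    by have := congr1 (gproj M true) E; rewrite linear0 linearD gproj_idem gproj_tf add0r.
  have xE : gproj M true x = x by rewrite [RHS](gprojD x) x0 add0r.
  have yE : gproj M false y = y by rewrite [RHS](gprojD y) y0 addr0.
  rewrite xE yE (homog true x)//; last by rewrite -xE; apply: gprojP.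
  rewrite (homog false y)//; last by rewrite -yE; apply: gprojP.
  exact: addr0.
have Rdom z : Z z -> exists w, R z w.
  have [x Xx x0] := subspace_neq0 sX X0.
  pose Y : set M := [set v | exists w, R v w].
  have <- : Y = Z; last by [].
  apply: (simple_sub sM _ _ _ x0).
  - apply/is_subcomodP; split.
    + split=> [|a u v [u' Ru] [v' Rv]]; last by exists (a *: u' + v'); apply: Rlin.
      exists 0, 0, 0; rewrite !linear0 addr0; split=> //; exact: sX.1.
    + by move=> f v [w /(Ract f) Rw]; exists (act M f w).
    + by move=> b v [w /(Rproj b) Rw]; exists (gproj M (~~ b) w).
  - by move=> _ [w [a [b [/XZ Xa /XZ Xb -> _]]]]; apply: (is_subspaceD sZ); apply: gZ.
  (* Every element of X is related to itself, so the domain of R is nonzero. *)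
  - by exists x, x, x; split=> //; [exact: gprojD|rewrite addrC; exact: gprojD].
have ex v : exists w, Z v -> R v w.
  by have [/Rdom[w Rw]|nZ] := EM (Z v); [exists w|exists 0].
have [u uR] := choice ex.
have Rfun v w w' : R v w -> R v w' -> w = w'.
  move=> Rw Rw'; apply/eqP; rewrite -subr_eq0; apply/eqP; apply: R0.
  by have := Rlin (-1) _ _ _ _ Rw' Rw; rewrite !scaleN1r addNr [- w' + _]addrC.
exists u; split.
  split=> [a v w Zv Zw|f v Zv|g v Zv gv].
  - apply: (Rfun (a *: v + w)); first by apply: uR; apply: sZ.2.
    by apply: Rlin; apply: uR.
  - by apply: (Rfun (act M f v)); [apply: uR; apply: aZ|apply: Ract; apply: uR].
  - have -> : u v = gproj M (~~ g) (u v); last exact: gprojP.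
    by apply: (Rfun v); [exact: uR|rewrite -{1}(gproj_id gv); apply: Rproj; apply: uR].
have [v Zv v0] := simple_neq0 sM.
exists v => // uv; apply: v0; apply: R0; apply: Rsym; rewrite -uv; exact: uR.
Qed.

(** The odd automorphism u maps the even part of the socle onto the odd part; a basis of the former
    and its image under u form a basis of the socle. *)
Lemma has_dim_odd M : simple_subcomod (socle M) -> meets true (socle M) M ->
  exists n, [/\ has_dim (socle_part M false) n, has_dim (socle_part M true) n &
                has_dim (socle M) (n + n)].
Proof.
move=> sM [u [hu [v Zv uv]]]; have sM' := simpleW sM.
case/is_subcomodP: (sM') => sZ aZ gZ.
have uI := phom_inj sM' hu (simple_phom_inj sM hu Zv uv).
have uZ := simple_image_socle sM sM hu Zv uv.
have [n P0] := socle_part_finite false sM; exists n.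
have [e [eP eU]] := P0.
have e_in i : socle M (e i) by have [] := eP i.
have uP i : socle_part M true (u (e i)).
  split; first by rewrite -uZ; exists (e i).
  by case: hu => _ _ h3; apply: (h3 false); [|have [] := eP i].
have lE (c : 'rV[k]_n) : \sum_i c 0 i *: u (e i) = u (lincomb e c).
  by rewrite (phom_lincomb sM' hu).
have lZ c : socle M (lincomb e c) by apply: subspace_lincomb.
have u_inj : injective (fun c => u (lincomb e c)).
  move=> c d /uI cd; have {}cd : lincomb e c = lincomb e d by apply: cd; apply: lZ.
  have [|c' [_ h]] := eU (lincomb e c).
    by apply: subspace_lincomb; [exact: socle_part_subspace|].
  by rewrite -(h c erefl) -(h d cd).
have u_surj w : socle_part M true w -> exists c, w = u (lincomb e c).
  move=> [Zw gw]; move: (Zw); rewrite -uZ => -[x Zx xw].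
  have gx : x = gproj M false x.
    apply: uI => //; first exact: gZ.
    by rewrite (phom_gproj sM' hu)// xw; apply/esym/gproj_id.
  have [|c [xE _]] := eU x; last by exists c; rewrite -xw xE.
  by split=> //; rewrite gx; apply: gprojP.
split=> //.
  exists (u \o e); split=> // w /u_surj[c ->]; exists c; split=> [|d].
    exact/esym/lE.
  by rewrite [X in _ = X]lE => /u_inj.
apply/(has_dimP _ sZ).
exists (lincomb (fun i => match fintype.split i with inl i => e i | inr i => u (e i) end)).
have catE (c d : 'rV[k]_n) : lincomb
    (fun i => match fintype.split i with inl i => e i | inr i => u (e i) end)
    (row_mx c d) = lincomb e c + u (lincomb e d).
  by rewrite -lE -lincomb_cat.
have ge c : gpart false (lincomb e c).
  by apply: subspace_lincomb; [exact: gpart_subspace|move=> i; have [] := eP i].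
have gue c : gpart true (u (lincomb e c)).
  by case: hu => _ _ h3; apply: (h3 false); [exact: lZ|exact: ge].
split.
  move=> c d /=; rewrite -(hsubmxK c) -(hsubmxK d) !catE => E.
  have E0 := congr1 (gproj M false) E; have E1 := congr1 (gproj M true) E.
  move: E0 E1; rewrite !linearD !(gproj_id (ge _)) !(gproj_id (gue _)).
  rewrite !(gproj_out (ge _)) !(gproj_out (gue _)) !addr0 !add0r => E0 /u_inj ->.
  congr row_mx; apply: u_inj; by rewrite /= E0.
apply/seteqP; split.
  move=> _ [c _ <-] /=; rewrite -(hsubmxK c) catE; apply: (is_subspaceD sZ); first exact: lZ.
  by rewrite -uZ; exists (lincomb e (rsubmx c)).
move=> w Zw; have [|c [cE _]] := eU (gproj M false w).
  by split; [apply: gZ|apply: gprojP].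
have [|d dE] := u_surj (gproj M true w); first by split; [apply: gZ|apply: gprojP].
by exists (row_mx c d) => //=; rewrite catE -dE (_ : lincomb e c = gproj M false w) -?gprojD.
Qed.

(* The l i are the coordinates in a basis of the degree b part of Z: since the
   counit has degree 0, they determine all maps of degree b from Z to C. *)
Lemma coordinate_functionals M (Z : set M) b m :
  is_subcomod Z -> has_dim (Z `&` gpart b) m ->
  exists l : 'I_m -> {linear M -> k^o},
  [/\ forall i v, gpart (~~ b) v -> l i v = 0,
      forall c : 'rV[k]_m, (forall s, Z s -> \sum_i c 0 i * l i s = 0) -> c = 0 &
      forall h : M -> C, phom (M := regular_comodule C) b Z h ->
        exists a : 'rV[k]_m, forall s, Z s -> h s = \sum_i cofun (l i) (a 0 i *: s)].
Proof.
move=> sZ' Zm; case/is_subcomodP: (sZ') => sZ aZ gZ.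
set P := Z `&` gpart b in Zm *.
have sP : is_subspace P by apply: is_subspaceI => //; apply: gpart_subspace.
have [e [Pe eU]] := Zm.
have [p [Pp pP]] := subspace_proj sP.
have ex v : exists c, p (gproj M b v) = lincomb e c.
  by have [c [cE _]] := eU _ (Pp (gproj M b v)); exists c.
have [co coE] := choice ex.
have e_inj : injective (lincomb e).
  move=> c d cd; have [c' [_ h]] := eU _ (subspace_lincomb c sP Pe).
  by rewrite -(h c erefl) -(h d cd).
have col : linear co.
  by move=> a x y; apply: e_inj; rewrite -coE !linearP /= !coE.
have ll i : linear ((fun v => co v 0 i) : M -> k^o).
  by move=> a x y; rewrite col !mxE.
exists (fun i => linmap (ll i)).
have co_e i : co (e i) = delta_mx 0 i.
  by apply: e_inj; rewrite -coE lincomb_delta gproj_id ?pP//; have [] := Pe i.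
split.
- move=> i v /gproj_out; rewrite negbK => v0.
  suff E : co v = 0 by rewrite /= E mxE.
  by apply: e_inj; rewrite -coE v0 !linear0.
- move=> c c0; apply/rowP => i; rewrite mxE -[RHS](c0 (e i)); last by have [] := Pe i.
  rewrite (bigD1 i)//= co_e mxE !eqxx mulr1 big1 ?addr0// => j ji.
  by rewrite mxE (negbTE ji) andbF mulr0.
(* The coefficients are those of the functional [counit \o h] in the coordinates of the degree b
   part. *)
move=> h hh; exists (\row_i counit C (h (e i))) => s Zs.
have Ze i : Z (e i) by have [] := Pe i.
apply: functional_separates => f; rewrite linear_sum.
have h2 : h (act M f s) = act (regular_comodule C) f (h s) by case: hh => _ + _; apply.
apply: (eq_trans (esym (counit_act f (h s)))).
apply: (eq_trans (esym (congr1 (counit C) h2))).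
have hD : h (act M f s) = h (gproj M b (act M f s)) + h (gproj M (~~ b) (act M f s)).
  rewrite -(phomD hh) -?gprojDb//; apply: gZ; exact: aZ.
rewrite hD linearD [X in _ + X]counit_deg0; last first.
  have : gpart (b (+) ~~ b) (h (gproj M (~~ b) (act M f s))).
    by case: hh => _ _; apply; [apply: gZ; apply: aZ|apply: gprojP].
  by rewrite addbN addbb.
rewrite addr0.
have -> : gproj M b (act M f s) = lincomb e (co (act M f s)).
  by rewrite -coE pP//; split; [apply: gZ; apply: aZ|apply: gprojP].
rewrite (phom_lincomb sZ' hh)// linear_sum; apply: eq_bigr => i _.
rewrite !linearZ functional_cofun mxE /=.
by apply: mulrC.
Qed.

End SimpleSocle.

(** By Schur's lemma u^2 is a scalar a = c^2. From (u - c)(u + c) = 0, the kernel of u - c is a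
    proper nonzero ungraded subcomodule unless u is c or -c, and a nonzero odd map is never a
    scalar. *)
Lemma odd_not_absolutely_simple (k : closedFieldType) (C : gcoalgebra k)
    (M : comodule C) :
  simple_subcomod (socle M) -> meets true (socle M) M ->
  ~ absolutely_simple_socle M.
Proof.
move=> sM [u [hu [v Zv uv]]] [_ abs]; have sM' := simpleW sM.
case/is_subcomodP: (sM') => sZ aZ gZ.
have uI := phom_inj sM' hu (simple_phom_inj sM hu Zv uv).
have uZ := simple_image_socle sM sM hu Zv uv.
have Zu x : socle M x -> socle M (u x) by move=> Zx; rewrite -uZ; exists x.
have not_scalar d : ~ (forall x, socle M x -> u x = d *: x).
  move=> ud; have hom g x : socle M x -> gpart g x -> u x = 0.
    move=> Zx gx; apply: (@gpart_disjoint _ _ g).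
      by rewrite ud//; apply: is_subspaceZ => //; apply: gpart_subspace.
    by case: hu => _ _ h3; apply: (h3 g).
  apply: uv; rewrite (gprojDb false v) (phomD hu) ?(hom _ _ _ (gprojP _ _)) ?addr0//; exact: gZ.
have hid : phom false (socle M) (idfun : M -> M) by [].
have v0 : v <> 0 by move=> v0; apply: uv; rewrite v0 (phom0 sM' hu).
have [a aE] := schur sM hid (phom_comp Zu hu hu) Zv v0
  (fun _ '(ex_intro2 x Zx E) => ex_intro2 _ _ (u (u x)) (Zu _ (Zu _ Zx)) E).
(* The monic polynomial X^2 - a. *)
have [c] := solve_monicpoly (fun i => if i == 0%N then a else 0) (isT : (0 < 2)%N).
rewrite big_ord_recl big_ord1 /= mulr1 mul0r addr0 => c2.
pose X := [set x | socle M x /\ u x = c *: x].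
have uX : is_ungraded_subcomod X.
  apply/ungraded_subcomodP; case: (hu) => h1 h2 _; split.
    split=> [|d x y [Zx xE] [Zy yE]]; first by split; [exact: sZ.1|rewrite (phom0 sM' hu) scaler0].
    split; first exact: sZ.2.
    by rewrite h1// xE yE scalerDr !scalerA mulrC.
  by move=> f x [Zx xE]; split; [exact: aZ|rewrite h2// xE linearZ_LR].
have [|X0|XZ] := abs X uX; first by move=> x [].
  apply: (not_scalar (- c)) => x Zx.
  have : X (u x + c *: x).
    have Zcx : socle M (c *: x) := is_subspaceZ c sZ Zx.
    split; first exact: (is_subspaceD sZ (Zu _ Zx) Zcx).
    rewrite (phomD hu) ?(phomZ sM' hu)//; last exact: Zu.
    rewrite -[u (u x)]/((u \o u) x) aE// -c2 /= scalerDr scalerA addrC.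
    by rewrite -expr2.
  by rewrite X0 => /eqP; rewrite addr_eq0 scaleNr => /eqP.
by apply: (not_scalar c) => x; rewrite -XZ => -[].
Qed.

(** * The decomposition *)

Section Decomposition.
Variables (k : closedFieldType) (C : gcoalgebra k).

(* [shiftb b M] absorbs the parity of the b-part: its even maps to C are the
   maps of degree b from M to C. *)
Lemma copies_embed (M : comodule C) b : simple_subcomod (socle M) ->
  exists F : {linear comod_copies (vdim (socle_part M b)) (shiftb b M) -> C},
  [/\ phom (M := regular_comodule C) false setT F, injective F &
      forall T : set (regular_comodule C), simple_subcomod T -> meets b T M ->
        T `<=` range F].
Proof.
move=> sM; have [n Pn] := socle_part_finite b sM.
rewrite (vdimE (socle_part_subspace M b) Pn).
have [l [l0 li lh]] := coordinate_functionals (simpleW sM) Pn.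
have MS (V : comodule C) (X : set V) (h : V -> M) v : simple_subcomod X ->
    phom b X h -> X v -> h v <> 0 -> h @` X = socle M.
  exact: simple_image_socle.
(* A map of degree b from T onto the socle has an inverse of degree b from the socle into C, which
   the coordinate functionals describe. *)
have rng (T : set (regular_comodule C)) : simple_subcomod T -> meets b T M ->
    exists h : M -> C, exists a : 'rV[k]_n, (forall t, T t -> exists2 s, t = h s & socle M s)
    /\ forall s, socle M s -> h s = \sum_i cofun (l i) (a 0 i *: s).
  move=> sT [p [hp [v Tv pv]]]; have pT := MS _ _ _ _ sT hp Tv pv.
  have [h [hh hK _]] := phom_inverse (simpleW sT) hp (simple_phom_inj sT hp Tv pv).
  rewrite pT in hh; have [a aE] := lh h hh; exists h, a; split=> // t Tt.
  by exists (p t); rewrite ?hK// -pT; exists t.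
(* Stated for arbitrary D and F so as to serve both M and its shift. *)
have sR (D : comodule C) (F : {linear D -> C}) (h : 'I_n -> M -> C) (T : set (regular_comodule C)) :
    (forall i m, range F (h i m)) -> 
    (exists g : M -> C, exists a : 'rV[k]_n, (forall t, T t -> exists2 s, t = g s & socle M s)
      /\ forall s, socle M s -> g s = \sum_i h i (a 0 i *: s)) -> T `<=` range F.
  move=> hF [g [a [gT gE]]] t /gT[s -> Zs]; rewrite gE//.
  by apply: is_subspace_sum => [|i _]; [exact: range_subspace|exact: hF].
case: b Pn l0 lh MS rng => Pn l0 lh MS rng; rewrite /shiftb.
  (* Vanishing on the even part of M is vanishing on the odd part of the shift, so the maps
     [cofun (l' i)] have degree 0. *)
  pose l' i : {linear shift M -> k^o} := l i.
  exists (dsum_lift (fun i => cofun (l' i)) : {linear comod_copies n (shift M) -> C}).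
  split.
  - exact (@phom_dsum_lift k C _ (fun _ : 'I_n => shift M) (regular_comodule C)
      (fun i => cofun (l' i)) (fun i => @phom_cofun k C false (shift M) (l' i) (l0 i))).
  - apply: (@copies_lift_injective k C (shift M) (socle M)) => [V X h v sX hX Xv hv|i v gv|c].
    + apply: (MS V X (h : V -> M) v sX _ Xv hv).
      by apply/(phom_shift (M := M) true).
    + exact: l0.
    + exact: li.
  - move=> T sT mT; apply: (sR _ _ (fun i => cofun (l i))) (rng T sT mT) => i m.
    apply: (@range_dsum_lift k C _ (fun _ : 'I_n => shift M) (regular_comodule C) (fun i => cofun (l' i)) i).
    by exists m.
exists (dsum_lift (fun i => cofun (l i)) : {linear comod_copies n M -> C}).
split.
- exact (@phom_dsum_lift k C _ (fun _ : 'I_n => M) (regular_comodule C)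
    (fun i => cofun (l i)) (fun i => @phom_cofun k C false M (l i) (l0 i))).
- exact: (@copies_lift_injective k C M (socle M)).
- move=> T sT mT; apply: (sR _ _ (fun i => cofun (l i))) (rng T sT mT) => i m.
  apply: (@range_dsum_lift k C _ (fun _ : 'I_n => M) (regular_comodule C) (fun i => cofun (l i)) i).
  by exists m.
Qed.

(* By induction on dim Y every finite-dimensional subcomodule Y of C lies in the
   range: if g extends the inverse of F from Y `&` range F to Y, then F g - 1
   kills a simple subcomodule of Y, so its image lies in the range of F. *)
Lemma iso_of_extensible (D : comodule C) (F : {linear D -> C}) :
  extensible D -> phom (M := regular_comodule C) false setT F -> injective F ->
  (forall T : set (regular_comodule C), simple_subcomod T -> T `<=` range F) ->
  comod_iso (regular_comodule C) D.
Proof.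
move=> eD hF iF FT.
have sR : is_subcomod (V := regular_comodule C) (range F) := phom_image (subcomodT D) hF.
have F0 x : [set: D] x -> F x = 0 -> x = 0 by rewrite -(linear0 F) => _ /iF.
have [G [hG GK FK]] := phom_inverse (subcomodT D) hF F0.
suff fin n (Y : set (regular_comodule C)) : is_subcomod Y -> has_dim Y n -> Y `<=` range F.
  have surj c : range F c.
    have [Y [sY [n Yn] _ Yc]] := subcomod_locally_finite (subcomodT (regular_comodule C)) (Logic.I : [set: C] c).
    exact: (fin n Y).
  have Gl : linear (G : regular_comodule C -> D).
    by case: hG => h1 _ _ a x y; apply: h1; apply: surj.
  exists (linmap Gl); split.
    apply/comod_homP; apply: phom_sub hG => x _; exact: surj.
  exists F => x; last exact: GK.
  by have [] := FK x (surj x).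
have [m] := ubnP n; elim: m n Y => // m IH n Y nm sY Yn.
have sX := subcomodI sY sR.
have fX : finite_dim (Y `&` range F).
  apply: (finite_dim_subspace (subcomod_subspace sY) (subcomod_subspace sX)); first by exists n.
  by move=> y [].
have [g [hg gX]] := eD _ _ false G sX fX (phom_sub (fun y (Yy : (Y `&` range F) y) => Yy.2) hG).
pose u : {linear regular_comodule C -> regular_comodule C} := (F \o g) \- idfun.
have hu : phom false setT u.
  have [_ f2 f3] := phom_comp (fun _ _ => Logic.I) hg hF.
  split=> [a x y _ _|f x _|b x _ bx]; first by rewrite linearP.
    rewrite -[LHS]/((F \o g) (act _ f x) - act _ f x) f2// -linearB//.
  apply: is_subspaceB; [exact: gpart_subspace| exact: f3|by []].
have [q [qd qn qE]] := has_dim_map u (subcomod_subspace sY) Yn.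
have uY : u @` Y `<=` range F.
  have suY := phom_image sY (phom_sub (fun _ _ => Logic.I) hu).
  have [Y0|/(subspace_neq0 (subcomod_subspace sY))[y Yy y0]] := EM (Y = [set 0]).
    move=> _ [y Yy <-]; move: Yy; rewrite Y0 => ->; rewrite linear0.
    exact: (subcomod_subspace sR).1.
  apply: (IH q) => //; apply: (@leq_trans n) => //; rewrite ltn_neqAle qn andbT.
  (* If the dimension did not drop, u would be injective on Y, but it vanishes on the simple T,
     which lies in the range of F. *)
  apply/eqP => qn'; have [T sT TY] := exists_simple sY Yy y0.
  have [t Tt t0] := simple_neq0 sT; apply: t0; apply: (qE qn'); first exact: TY.
  have Rt := FT T sT t Tt.
  rewrite -[LHS]/(F (g t) - t) gX; last by split=> //; apply: TY.
  by rewrite (FK t Rt).2 subrr.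
move=> y Yy; have -> : y = F (g y) - u y.
  by rewrite -[u y]/(F (g y) - y) opprB addrC subrK.
apply: (is_subspaceB (subcomod_subspace sR)); first by exists (g y).
by apply: uY; exists y.
Qed.

Variables (J : choiceType) (I : J -> comodule C).
Hypothesis I_cover : forall j, exists S : comodule C,
  simple_comod S /\ injective_cover S (I j).
Hypothesis I_classes : forall S : comodule C, simple_comod S ->
  exists! j, injective_cover S (I j) \/ injective_cover (shift S) (I j).
Hypothesis I_embeds : forall j, embeds (I j) (regular_comodule C).

Let I_simple j : simple_subcomod (socle (I j)).
Proof. by have [S [sS cS]] := I_cover j; apply: simple_socle_of_cover sS cS. Qed.

Let I_extensible j : extensible (I j).
Proof. by have [S [sS cS]] := I_cover j; apply: extensible_of_cover cS (I_embeds j). Qed.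

Lemma class_unique (V : comodule C) (T : set V) b b' i j : simple_subcomod T ->
  meets b T (I i) -> meets b' T (I j) -> i = j.
Proof.
move=> sT mi mj; have [S [f [sS hf fi fT]]] := simple_model sT.
have mS c l : meets c T (I l) -> meets c [set: S] (I l).
  move=> [p [hp [v Tv pv]]]; exists (p \o f); split.
    by apply: (phom_comp (Y := T) _ hf hp) => s _; rewrite -fT; exists s.
  by move: Tv pv; rewrite -fT => -[s _ <-] pv; exists s.
have cov c l : meets c T (I l) -> injective_cover S (I l) \/ injective_cover (shift S) (I l).
  move=> /mS ml; have [S0 [sS0 cS0]] := I_cover l.
  by have := cover_of_meets sS0 cS0 sS ml; case: c ml => _ /=; [right|left].
have [l [_ lU]] := I_classes sS.
by rewrite -(lU i (cov _ _ mi)) -(lU j (cov _ _ mj)).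
Qed.

Lemma class_exists (V : comodule C) (T : set V) : simple_subcomod T ->
  exists j b, meets b T (I j).
Proof.
move=> sT; have [S [f [sS hf fi fT]]] := simple_model sT.
have [j [[cj|cj] _]] := I_classes sS; exists j.
  by exists false; apply: (meets_of_cover (b := false) sS hf fi fT cj).
by exists true; apply: (meets_of_cover (b := true) sS hf fi fT cj).
Qed.

(** Going back along one map and forward along the other gives a map of degree b (+) b', which is
    odd, from the socle to [I j]. *)
Lemma class_parity j (V : comodule C) (T : set V) b b' : simple_subcomod T ->
  meets b T (I j) -> meets b' T (I j) -> b <> b' -> meets true (socle (I j)) (I j).
Proof.
move=> sT [p [hp [v Tv pv]]] mj bb.
have -> : true = b (+) b' by case: b b' bb {hp mj} => [] [].
have pT := simple_image_socle (I_simple j) sT hp Tv pv.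
exact: (meets_comp sT (I_simple j) hp Tv pv pT mj).
Qed.

(* D is, up to isomorphism, the injective hull of the part of the socle of C
   whose simple constituents belong to the classes in A. *)
Definition isotypic (D : comodule C) (A : set J) : Prop :=
  [/\ extensible D,
      (forall (V : comodule C) (T : set V), simple_subcomod T -> meets false T D ->
        exists j b, A j /\ meets b T (I j)) &
      exists F : {linear D -> C},
      [/\ phom (M := regular_comodule C) false setT F, injective F &
          forall (T : set (regular_comodule C)) b j, simple_subcomod T -> A j ->
            meets b T (I j) -> T `<=` range F]].

(** A simple comodule embedding in two summands would, by [class_unique], give a class common to
    both; this is what [dsum_lift_injective] requires. *)
Lemma isotypic_dsum (K : choiceType) (D : K -> comodule C) (A : K -> set J) :
  (forall t, isotypic (D t) (A t)) ->
  (forall s t j, A s j -> A t j -> s = t) ->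
  isotypic (comod_dsum D) (\bigcup_t A t).
Proof.
move=> DA Adisj; split.
- by apply: dsum_extensible => t; have [] := DA t.
- move=> V T sT /meets_dsum[t /((let: And3 _ h _ := DA t in h) _ _ sT)[j [b [Aj mj]]]].
  by exists j, b; split=> //; exists t.
have ex t : exists F : {linear D t -> C},
      [/\ phom (M := regular_comodule C) false setT F, injective F &
          forall (T : set (regular_comodule C)) b j, simple_subcomod T -> A t j ->
            meets b T (I j) -> T `<=` range F].
  by have [] := DA t.
pose F t := sval (cid (ex t)).
have FP t := svalP (cid (ex t)).
exists (dsum_lift F : {linear comod_dsum D -> C}); split.
- by apply: (@phom_dsum_lift k C K D (regular_comodule C) F) => t; have [] := FP t.
- apply: (@dsum_lift_injective k C K D (regular_comodule C) F) => [t|t|V X s t sX ms mt].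
  + by have [] := FP t.
  + by have [] := FP t.
  + have [_ /(_ V X sX ms)[i [b [Ai mi]]] _] := DA s.
    have [_ /(_ V X sX mt)[j [c [Aj mj]]] _] := DA t.
    by apply: (Adisj _ _ i) => //; rewrite (class_unique sX mi mj).
- move=> T b j sT [t _ Aj] mj x Tx.
  apply: (@range_dsum_lift k C K D (regular_comodule C) F t).
  by have [_ _ /(_ T b j sT Aj mj)] := FP t; apply.
Qed.

Lemma isotypic_sum2 (D D' : comodule C) (A A' : set J) :
  isotypic D A -> isotypic D' A' -> (forall j, A j -> A' j -> False) ->
  isotypic (comod_sum2 D D') (A `|` A').
Proof.
move=> iD iD' AA'; have := @isotypic_dsum bool (fun b => if b then D else D')
  (fun b => if b then A else A').
have -> : \bigcup_b (if b then A else A') = A `|` A'.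
  apply/seteqP; split=> [j [[] _ Aj]|j [Aj|Aj]]; [by left|by right| |].
    by exists true.
  by exists false.
by apply=> [[]//|[] [] j // h h']; case: (AA' j).
Qed.

(** A simple comodule embedding both in [I j] and in its shift would give the socle an odd
    automorphism, so the two blocks of copies do not interfere. *)
Lemma isotypic_absolutely_simple j : absolutely_simple_socle (I j) ->
  isotypic (comod_sum2 (comod_copies (vdim (socle_part (I j) false)) (I j))
              (comod_copies (vdim (socle_part (I j) true)) (shift (I j)))) [set j].
Proof.
move=> abs; have sM := I_simple j.
set D0 := comod_copies _ (I j); set D1 := comod_copies _ (shift (I j)).
have m0 (V : comodule C) (T : set V) : meets false T D0 -> meets false T (I j).
  by move=> /meets_dsum[].
have m1 (V : comodule C) (T : set V) : meets false T D1 -> meets true T (I j).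
  by move=> /meets_dsum[i /meets_shift].
have [F0 [hF0 iF0 rF0]] := copies_embed false sM.
have [F1 [hF1 iF1 rF1]] := copies_embed true sM.
(* [comod_sum2] indexes its first summand by [true], so the summand of index b carries the parity
   [~~ b]. *)
pose Dt (b : bool) := if b then D0 else D1.
have mt (b : bool) (V : comodule C) (T : set V) : meets false T (Dt b) -> meets (~~ b) T (I j).
  by case: b; [exact: m0|exact: m1].
split.
- apply: dsum_extensible => b; case: b; apply: dsum_extensible => i; first exact: I_extensible.
  exact: shift_extensible.
- move=> V T sT /meets_dsum[b /mt mj]; by exists j, (~~ b).
pose F (b : bool) : {linear Dt b -> C} :=
  match b return {linear Dt b -> C} with true => F0 | false => F1 end.
exists (dsum_lift F : {linear comod_dsum Dt -> C}); split.
- by apply: (@phom_dsum_lift k C _ Dt (regular_comodule C) F) => -[].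
- apply: (@dsum_lift_injective k C _ Dt (regular_comodule C) F) => [[]|[]|V X s t sX /mt ms /mt mt'] //.
  apply: contrapT => st; apply: (odd_not_absolutely_simple sM _ abs).
  by apply: (class_parity sX ms mt') => /negb_inj.
- move=> T b _ sT -> mj x Tx.
  apply: (@range_dsum_lift k C _ Dt (regular_comodule C) F (~~ b)).
  by case: b mj => mj; [apply: (rF1 T)|apply: (rF0 T)].
Qed.

(** Half the dimension of the socle is the dimension of its even part. Composition with the odd
    automorphism turns odd maps into even ones, so the unshifted copies already reach both
    parities. *)
Lemma isotypic_not_absolutely_simple j : ~ absolutely_simple_socle (I j) ->
  isotypic (comod_copies (vdim (socle (I j)))./2 (I j)) [set j].
Proof.
move=> nabs; have sM := I_simple j.
have odd_j := odd_automorphism sM nabs.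
have [n [n0 n1 nn]] := has_dim_odd sM odd_j.
rewrite (vdimE (subcomod_subspace (simpleW sM)) nn) addnn doubleK.
rewrite -(vdimE (socle_part_subspace (I j) false) n0).
have [F [hF iF rF]] := copies_embed false sM.
split.
- by apply: dsum_extensible.
- by move=> V T sT /meets_dsum[i mj]; exists j, false.
exists F; split=> // T b _ sT -> mj; apply: rF => //.
case: b mj => // -[p [hp [v Tv pv]]].
have pT := simple_image_socle sM sT hp Tv pv.
case: odd_j => u [hu [w Zw uw]].
exists (u \o p); split.
  by apply: (phom_comp _ hp hu) => t Tt; rewrite -pT; exists t.
by move: Zw uw; rewrite -pT => -[t Tt <-] ut; exists t.
Qed.

End Decomposition.

Theorem proposition1 (k : closedFieldType) (C : gcoalgebra k)
    (J : choiceType) (I : J -> comodule C)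
    (I_cover : forall j, exists S : comodule C,
       simple_comod S /\ injective_cover S (I j))
    (I_classes : forall S : comodule C, simple_comod S ->
       exists! j, injective_cover S (I j) \/ injective_cover (shift S) (I j))
    (I_embeds : forall j, embeds (I j) (regular_comodule C)) :
  let F1 : set J := [set j | absolutely_simple_socle (I j)] in
  let F2 : set J := [set: J] `\` F1 in
  [/\ forall j, finite_dim (socle (I j)),
      forall j, F2 j -> ~~ odd (vdim (socle (I j))) &
      comod_iso (regular_comodule C)
        (comod_sum2
           (comod_dsum (fun j : F1 =>
              comod_sum2
                (comod_copies (vdim (socle_part (I (sval j)) false)) (I (sval j)))
                (comod_copies (vdim (socle_part (I (sval j)) true))
                   (shift (I (sval j))))))
           (comod_dsum (fun j : F2 =>
              comod_copies (vdim (socle (I (sval j))))./2 (I (sval j)))))].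
Proof.
move=> F1 F2.
have sI j : simple_subcomod (socle (I j)).
  by have [S [sS cS]] := I_cover j; apply: simple_socle_of_cover sS cS.
split=> [j|j [_ nabs]|]; first exact: simple_finite.
  have [n [_ _ nn]] := has_dim_odd (sI j) (odd_automorphism (sI j) nabs).
  by rewrite (vdimE (subcomod_subspace (simpleW (sI j))) nn) addnn odd_double.
have F1P (j : F1) : absolutely_simple_socle (I (sval j)) by have := set_valP j.
have F2P (j : F2) : ~ absolutely_simple_socle (I (sval j)) by have [] := set_valP j.
have D1 := isotypic_dsum I_cover I_classes
  (fun j : F1 => isotypic_absolutely_simple I_cover I_embeds (F1P j))
  (fun s t j js jt => val_inj (etrans (esym js) jt)).
have D2 := isotypic_dsum I_cover I_classes
  (fun j : F2 => isotypic_not_absolutely_simple I_cover I_embeds (F2P j))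
  (fun s t j js jt => val_inj (etrans (esym js) jt)).
have [|eD _ [F [hF iF rF]]] := isotypic_sum2 I_cover I_classes D1 D2.
  (* A class common to both families would be absolutely simple and not. *)
  by move=> _ [s _ ->] [t _ st]; apply: (F2P t); rewrite -st; apply: F1P.
apply: (iso_of_extensible eD hF iF) => T sT.
have [j [b mj]] := class_exists I_classes sT.
(* Every simple T in C belongs to a class in F1 or in F2, so the range of F contains it. *)
have [j1|j2] := EM (F1 j); apply: (rF T b j) => //.
  by left; exists (SigSub (mem_set j1)).
by right; exists (SigSub (mem_set (conj Logic.I j2 : F2 j))).
Qed.
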